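(* There exist an absolute constant $c>0$ and a polynomial-time algorithm with the following guarantee. Given a connected graph $G=(V,E)$ with $n$ vertices and node capacities $\mathrm{cap}:V\to\mathbb{R}_{\ge 0}$, where $k$ denotes the minimum capacity of a node separator of $G$, the algorithm outputs a fractional connected domatic packing of $G$ (respecting $\mathrm{cap}$) of size at least $c\cdot k/\ln n$, i.e.\ of size $\Omega(k/\ln n)$.
   Context: All graphs are finite, simple, undirected. A set $D\subseteq V$ is a dominating set if every vertex outside $D$ has a neighbor in $D$; it is a connected dominating set if moreover the induced subgraph $G[D]$ is connected. A set $S\subseteq V$ is a node separator if $G-S$ (the graph obtained by deleting the vertices of $S$) has at least two connected components. The capacity of a set $S$ is $\sum_{v\in S}\mathrm{cap}(v)$. A fractional connected domatic packing respecting $\mathrm{cap}$ is a finite collection of connected dominating sets $D_1,\dots,D_\ell$ with weights $\alpha_1,\dots,\alpha_\ell\ge 0$ such that for every vertex $v$, $\sum_{i:v\in D_i}\alpha_i\le \mathrm{cap}(v)$; its size is $\sum_i\alpha_i$. *)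

(* Defs.v *)
From HB Require Import structures.
From mathcomp Require Import all_boot all_order all_algebra.
From mathcomp Require Import reals exp.
Set Implicit Arguments.
Unset Strict Implicit.
Unset Printing Implicit Defensive.
Import Order.TTheory GRing.Theory Num.Theory.
Local Open Scope ring_scope.

Record sgraph (T : finType) := SGraph {
  adj :> rel T;
  adj_sym : symmetric adj;
  adj_irr : irreflexive adj }.

Section Graphs.
Variables (T : finType) (G : sgraph T).
Implicit Types (D S : {set T}).

(* The edges of G[D]; the vertices outside D stay in T as isolated points, so
   every use below restricts attention to D itself. *)
Definition induced D : rel T := [rel x y | [&& x \in D, y \in D & G x y]].

Definition induced_connected D : Prop :=
  D != set0 /\ {in D &, forall x y, connect (induced D) x y}.

Definition graph_connected : Prop := induced_connected [set: T].

Definition dominating D : Prop :=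
  forall x, x \notin D -> exists2 y, y \in D & G x y.

Definition connected_dominating D : Prop :=
  dominating D /\ induced_connected D.

Definition node_separator S : Prop :=
  (2 <= n_comp (induced (~: S)) (~: S))%N.

Variables (R : realType) (cap : T -> R).

Definition capacity S : R := \sum_(v in S) cap v.

Definition min_separator_capacity (k : R) : Prop :=
  (exists2 S, node_separator S & capacity S = k) /\
  (forall S, node_separator S -> k <= capacity S).

Definition cd_packing (l : nat) (D : 'I_l -> {set T}) (alpha : 'I_l -> R) :
    Prop :=
  [/\ forall i, connected_dominating (D i),
      forall i, 0 <= alpha i &
      forall v, \sum_(i | v \in D i) alpha i <= cap v].

End Graphs.

(* Algorithms on real data are programs of a real RAM.  The memory consists of
   integer arrays and real arrays, all named by natural numbers; array names
   are literal in the program, whereas indices are computed.  Integers only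
   have addition and truncated subtraction, so that charging one unit per
   operation is legitimate; reals have exact field operations and comparisons,
   but no rounding, and the only real literals are integers.  Expressions occur
   in the program text and so have bounded size: charging one unit per executed
   assignment or test counts operations up to a constant factor depending on
   the program only. *)

Inductive iexp :=
| IConst of nat
| ILoad of nat & iexp
| IAdd of iexp & iexp
| ISub of iexp & iexp.

Inductive rexp :=
| RConst of nat
| RLoad of nat & iexp
| RAdd of rexp & rexp
| RSub of rexp & rexp
| RMul of rexp & rexp
| RDiv of rexp & rexp.

Inductive bexp :=
| BIle of iexp & iexp
| BRle of rexp & rexp
| BNot of bexp
| BAnd of bexp & bexp.

Inductive cmd :=
| CSkip
| CIStore of nat & iexp & iexp
| CRStore of nat & iexp & rexp
| CSeq of cmd & cmd
| CIf of bexp & cmd & cmd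
| CWhile of bexp & cmd.

Definition upd (A : Type) (m : nat -> nat -> A) (a i : nat) (x : A) :
    nat -> nat -> A :=
  fun b j => if (b == a) && (j == i) then x else m b j.

Section Semantics.
Variable R : realType.

Record state := State {
  imem : nat -> nat -> nat;
  rmem : nat -> nat -> R }.

Implicit Types s : state.

Fixpoint ieval s (e : iexp) : nat :=
  match e with
  | IConst m => m
  | ILoad a e1 => imem s a (ieval s e1)
  | IAdd e1 e2 => (ieval s e1 + ieval s e2)%N
  | ISub e1 e2 => (ieval s e1 - ieval s e2)%N
  end.

(* Division by zero returns 0. *)
Fixpoint reval s (e : rexp) : R :=
  match e with
  | RConst m => m%:R
  | RLoad a e1 => rmem s a (ieval s e1)
  | RAdd e1 e2 => reval s e1 + reval s e2
  | RSub e1 e2 => reval s e1 - reval s e2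
  | RMul e1 e2 => reval s e1 * reval s e2
  | RDiv e1 e2 => reval s e1 / reval s e2
  end.

Fixpoint beval s (b : bexp) : bool :=
  match b with
  | BIle e1 e2 => (ieval s e1 <= ieval s e2)%N
  | BRle e1 e2 => reval s e1 <= reval s e2
  | BNot b1 => ~~ beval s b1
  | BAnd b1 b2 => beval s b1 && beval s b2
  end.

(* exec P s t s' : started in s, P halts in s' after t steps. *)
Inductive exec : cmd -> state -> nat -> state -> Prop :=
| ExecSkip s : exec CSkip s 1 s
| ExecIStore a i e s :
    exec (CIStore a i e) s 1
      (State (upd (imem s) a (ieval s i) (ieval s e)) (rmem s))
| ExecRStore a i e s :
    exec (CRStore a i e) s 1
      (State (imem s) (upd (rmem s) a (ieval s i) (reval s e)))
| ExecSeq P Q s s1 s2 t1 t2 :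
    exec P s t1 s1 -> exec Q s1 t2 s2 -> exec (CSeq P Q) s (t1 + t2) s2
| ExecIfTrue b P Q s s1 t :
    beval s b = true -> exec P s t s1 -> exec (CIf b P Q) s t.+1 s1
| ExecIfFalse b P Q s s1 t :
    beval s b = false -> exec Q s t s1 -> exec (CIf b P Q) s t.+1 s1
| ExecWhileFalse b P s :
    beval s b = false -> exec (CWhile b P) s 1 s
| ExecWhileTrue b P s s1 s2 t1 t2 :
    beval s b = true -> exec P s t1 s1 -> exec (CWhile b P) s1 t2 s2 ->
    exec (CWhile b P) s (t1 + t2).+1 s2.

(* Input format: cell 0 of integer array 0 holds n, integer array 1 holds the
   n x n adjacency matrix row by row, and real array 0 holds the capacities.
   All other cells are 0. *)
Definition input (n : nat) (G : sgraph 'I_n) (cap : 'I_n -> R) : state :=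
  State
    (fun a m =>
       match a with
       | 0 => if m == 0 then n else 0
       | 1 => [exists i : 'I_n, exists j : 'I_n, (m == i * n + j) && G i j]
       | _ => 0
       end)%N
    (fun a m => if a == 0%N then oapp cap 0 (insub m) else 0).

(* Output format: cell 0 of integer array 2 holds the number l of sets, the
   rows of the l x n matrix in integer array 3 are the indicator vectors of
   the sets, and real array 1 holds the l weights. *)
Definition out_count s : nat := imem s 2 0.

Definition out_set (n : nat) s (i : 'I_(out_count s)) : {set 'I_n} :=
  [set v : 'I_n | imem s 3 (i * n + v) != 0%N].

Definition out_weight s (i : 'I_(out_count s)) : R := rmem s 1 i.

End Semantics.

(* Main.v *)
Require Import Defs.
From HB Require Import structures.
From mathcomp Require Import all_boot all_order all_algebra.
From mathcomp Require Import reals sequences exp zify ring lra.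
Set Implicit Arguments.
Unset Strict Implicit.
Unset Printing Implicit Defensive.
Import Order.TTheory GRing.Theory Num.Theory.
Local Open Scope ring_scope.

(** The packing comes from multiplicative weights.  Start from the weights
    [w = 1 / cap] and repeat [n ^ 3] times: find a cheap connected dominating
    set [D], give it the weight [c = min_D cap], and multiply [w v] by
    [1 + c / cap v] on [D].  Dividing all the weights by the maximal relative
    load makes the packing feasible.  If every [D] costs at most
    [beta * Phi / k], where [Phi = sum cap * w], then [Phi] grows by at most
    [exp (beta * c / k)] per round, while a vertex of relative load [lam] forces
    [Phi >= exp (lam / 2)]; since [lam >= n ^ 2 >= 4 ln n] the initial value of
    [Phi] is negligible and the packing has size at least [k / (4 beta)].

    A set with [beta = 6 ln n] is found greedily.  Call the components of [G[D]]
    and the undominated vertices pieces, [q] in number.  A spider is a center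
    [v] together with light neighbours ([w <= r]); adding it to [D] merges all
    the pieces it touches.  Enlarge each piece by its light neighbours: unless a
    light vertex touches two pieces (and is itself a good spider), the boundary
    of the enlarged piece is a node separator, of capacity at least [k].
    Summing over the pieces, and bounding how often a vertex lies on a boundary
    by the number of pieces its spider touches, gives a spider whose cost per
    merge is at most [2 r], as soon as [k q r > 2 Phi].  So the cheapest spider
    costs at most [6 Phi / (k q)] per merge, and these costs sum to
    [6 Phi ln n / k]. *)

(** * Structured programs *)

Inductive prog :=
| PSkip
| PIStore of nat & iexp & iexp
| PRStore of nat & iexp & rexp
| PSeq of prog & prog
| PIf of bexp & prog & prog
| PFor of nat & prog.

Definition ireg (x : nat) : iexp := ILoad x (IConst 0).
Definition rreg (x : nat) : rexp := RLoad x (IConst 0).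
Local Notation PISet x e := (PIStore x (IConst 0) e).
Local Notation PRSet x e := (PRStore x (IConst 0) e).
Local Notation PWhen b p := (PIf b p PSkip).
Local Notation "p ;; q" := (PSeq p q) (at level 61, right associativity).

Definition size_reg : nat := 0.

Definition for_test (x : nat) : bexp := BNot (BIle (ireg size_reg) (ireg x)).
Definition for_incr (x : nat) : cmd :=
  CIStore x (IConst 0) (IAdd (ireg x) (IConst 1)).

Fixpoint compile (p : prog) : cmd :=
  match p with
  | PSkip => CSkip
  | PIStore a i e => CIStore a i e
  | PRStore a i e => CRStore a i e
  | PSeq p q => CSeq (compile p) (compile q)
  | PIf b p q => CIf b (compile p) (compile q)
  | PFor x q => CSeq (CIStore x (IConst 0) (IConst 0))
                  (CWhile (for_test x) (CSeq (compile q) (for_incr x)))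
  end.

Fixpoint int_writes (p : prog) : seq nat :=
  match p with
  | PIStore a _ _ => [:: a]
  | PSeq p q | PIf _ p q => int_writes p ++ int_writes q
  | PFor x q => x :: int_writes q
  | _ => [::]
  end.

Fixpoint real_writes (p : prog) : seq nat :=
  match p with
  | PRStore a _ _ => [:: a]
  | PSeq p q | PIf _ p q => real_writes p ++ real_writes q
  | PFor _ q => real_writes q
  | _ => [::]
  end.

Fixpoint well_formed (p : prog) : bool :=
  match p with
  | PIStore a _ _ => a != size_reg
  | PSeq p q | PIf _ p q => well_formed p && well_formed q
  | PFor x q => [&& x != size_reg, x \notin int_writes q & well_formed q]
  | _ => true
  end.

Fixpoint time_bound (p : prog) : {poly nat} :=
  match p with
  | PSeq p q => time_bound p + time_bound q
  | PIf _ p q => time_bound p + time_bound q + 1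
  | PFor _ q => 'X * (time_bound q + 2%N%:P) + 2%N%:P
  | _ => 1
  end.

Lemma size_notin_writes (p : prog) :
  well_formed p -> size_reg \notin int_writes p.
Proof.
elim: p => //= [a _ _|p IHp q IHq|_ p IHp q IHq|x q IHq].
- by rewrite inE eq_sym.
- by rewrite mem_cat negb_or => /andP[/IHp-> /IHq->].
- by rewrite mem_cat negb_or => /andP[/IHp-> /IHq->].
- by rewrite inE negb_or eq_sym => /and3P[-> _ /IHq->].
Qed.

Section Memory.
Variable A : Type.
Implicit Types (m : nat -> nat -> A) (a b i j : nat).

Lemma upd_neq m a b i j (v : A) : b != a -> upd m a i v b j = m b j.
Proof. by rewrite /upd => /negPf->. Qed.

Lemma updE m a b i j (v : A) :
  upd m a i v b j = if (b == a) && (j == i) then v else m b j.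
Proof. by []. Qed.

End Memory.
Arguments upd : simpl never.

Section Run.
Variable R : realType.
Implicit Types (s : state R) (p q : prog) (a i j x : nat).

Definition iset a i (v : nat) s : state R :=
  State (upd (imem s) a i v) (rmem s).

Definition rset a i (v : R) s : state R :=
  State (imem s) (upd (rmem s) a i v).

Definition for_state x (f : state R -> state R) s i : state R :=
  iteri i (fun i s => iset x 0 i.+1 (f s)) (iset x 0 0 s).

Fixpoint run p s : state R :=
  match p with
  | PSkip => s
  | PIStore a i e => iset a (ieval s i) (ieval s e) s
  | PRStore a i e => rset a (ieval s i) (reval s e) s
  | PSeq p q => run q (run p s)
  | PIf b p q => if beval s b then run p s else run q s
  | PFor x q => for_state x (run q) s (imem s size_reg 0)
  end.

Record agree p s s' : Prop := Agree {
  agree_int : forall a j, a \notin int_writes p -> imem s' a j = imem s a j;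
  agree_real : forall a j, a \notin real_writes p -> rmem s' a j = rmem s a j }.

Lemma for_state_agree x q s i :
  (forall s', agree q s' (run q s')) ->
  agree (PFor x q) s (for_state x (run q) s i).
Proof.
move=> agq; split=> a j /=.
  rewrite inE negb_or => /andP[ax aq].
  by elim: i => [|i IHi] /=; rewrite upd_neq ?(agree_int (agq _)).
by move=> aq; elim: i => [|i IHi] //=; rewrite (agree_real (agq _)).
Qed.

Lemma run_agree p s : agree p s (run p s).
Proof.
elim: p s => [|a i e|a i e|p IHp q IHq|b p IHp q IHq|x q IHq] s //=.
- by split=> // b j; rewrite inE => ?; apply: upd_neq.
- by split=> // b j; rewrite inE => ?; apply: upd_neq.
- split=> a j; rewrite /= mem_cat negb_or => /andP[ap aq].
    by rewrite (agree_int (IHq _)) ?(agree_int (IHp _)).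
  by rewrite (agree_real (IHq _)) ?(agree_real (IHp _)).
- split=> a j; rewrite /= mem_cat negb_or => /andP[ap aq].
    by case: ifP => _; rewrite ?(agree_int (IHp _)) ?(agree_int (IHq _)).
  by case: ifP => _; rewrite ?(agree_real (IHp _)) ?(agree_real (IHq _)).
- exact: for_state_agree.
Qed.

Lemma imem_run p s a j : a \notin int_writes p ->
  imem (run p s) a j = imem s a j.
Proof. exact: (agree_int (run_agree p s)). Qed.

Lemma rmem_run p s a j : a \notin real_writes p ->
  rmem (run p s) a j = rmem s a j.
Proof. exact: (agree_real (run_agree p s)). Qed.

Lemma for_state_counter x f s i : imem (for_state x f s i) x 0 = i.
Proof. by case: i => [|i]; rewrite /= updE !eqxx. Qed.

Lemma for_state_size x q s i : well_formed (PFor x q) ->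
  imem (for_state x (run q) s i) size_reg 0 = imem s size_reg 0.
Proof.
move=> wf; have := for_state_agree x s i (run_agree q).
by move/agree_int; apply; apply: size_notin_writes.
Qed.

Lemma exec_for x q s (B : nat -> nat) : well_formed (PFor x q) ->
  (forall s', exists2 t, exec (compile q) s' t (run q s') &
     (t <= B (imem s' size_reg 0))%N) ->
  exists2 t, exec (compile (PFor x q)) s t (run (PFor x q) s) &
    (t <= imem s size_reg 0 * (B (imem s size_reg 0) + 2) + 2)%N.
Proof.
move=> wf exq; set n := imem s size_reg 0; set st := for_state x (run q) s.
pose W := CWhile (for_test x) (CSeq (compile q) (for_incr x)).
have loop d i : (i + d = n)%N ->
    exists2 t, exec W (st i) t (st n) & (t <= d * (B n + 2) + 1)%N.
  elim: d i => [|d IHd] i; rewrite ?addn0 ?addnS => iN.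
    rewrite iN; exists 1%N => //; apply: ExecWhileFalse.
    by rewrite /= for_state_size // for_state_counter leqnn.
  have [t2 e2 le_t2] := IHd i.+1 iN.
  have [t1 e1] := exq (st i); rewrite for_state_size // -/n => le_t1.
  exists ((t1 + 1) + t2).+1; last by move: (B n) le_t1 le_t2 => b; nia.
  apply: ExecWhileTrue e2.
    by rewrite /= for_state_size // for_state_counter -ltnNge -/n -iN leq_addr.
  apply: (ExecSeq e1); have := ExecIStore x (IConst 0)
    (IAdd (ireg x) (IConst 1)) (run q (st i)).
  have /and3P[_ xq _] := wf.
  by rewrite /= imem_run // for_state_counter addn1.
have [t et le_t] := loop n 0%N (add0n _); exists (1 + t)%N; last by lia.
by apply: ExecSeq et; apply: ExecIStore.
Qed.

Lemma compile_run p s : well_formed p ->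
  exists2 t, exec (compile p) s t (run p s) &
    (t <= (time_bound p).[imem s size_reg 0])%N.
Proof.
elim: p s => [|a i e|a i e|p IHp q IHq|b p IHp q IHq|x q IHq] s.
- by exists 1%N; [constructor | rewrite hornerE].
- by exists 1%N; [constructor | rewrite hornerE].
- by exists 1%N; [constructor | rewrite hornerE].
- move=> /= /andP[wp wq].
  have [t1 e1 le1] := IHp s wp; have [t2 e2] := IHq (run p s) wq.
  rewrite imem_run ?size_notin_writes // => le2.
  exists (t1 + t2)%N; first exact: ExecSeq e1 e2.
  by rewrite hornerD; apply: leq_add.
- move=> /= /andP[wp wq].
  have [t1 e1 le1] := IHp s wp; have [t2 e2 le2] := IHq s wq.
  have -> : (time_bound p + time_bound q + 1).[imem s size_reg 0] =
      ((time_bound p).[imem s size_reg 0] +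
       (time_bound q).[imem s size_reg 0])%N.+1.
    by rewrite !hornerD hornerC -[RHS]addn1.
  case: (boolP (beval s b)) => [bT|/negbTE bF].
    exists t1.+1; first exact: ExecIfTrue.
    exact: leq_trans le1 (leq_addr _ _).
  exists t2.+1; first exact: ExecIfFalse.
  exact: leq_trans le2 (leq_addl _ _).
- move=> wf; have /and3P[_ _ wq] := wf.
  rewrite [time_bound _]/= !hornerE; exact: (exec_for s wf (IHq ^~ wq)).
Qed.

(* The invariant only has to mention what the loop changes: every intermediate
   state agrees with the initial one on the other arrays. *)
Lemma for_ind (n : nat) (J : {set 'I_n} -> state R -> Prop) x q s :
  imem s size_reg 0 = n -> well_formed (PFor x q) ->
  (forall A v s', J A s' -> J A (iset x 0 v s')) -> J set0 s ->
  (forall (i : 'I_n) (A : {set 'I_n}) s', i \notin A -> agree (PFor x q) s s' ->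
     imem s' x 0 = i -> J A s' -> J (i |: A) (run q s')) ->
  J setT (run (PFor x q) s).
Proof.
move=> sn wf Jx J0 Jq; pose st := for_state x (run q) s.
have Jst i : (i <= n)%N -> J [set y : 'I_n | (y < i)%N] (st i).
  elim: i => [_|i IHi lt_in].
    rewrite (_ : [set _ | _] = set0); first exact: Jx.
    by apply/setP => y; rewrite !inE.
  rewrite (_ : [set _ | _] = Ordinal lt_in |: [set y : 'I_n | (y < i)%N]).
    apply: Jx; apply: Jq (IHi (ltnW lt_in)); first by rewrite inE ltnn.
      exact: (for_state_agree _ _ _ (run_agree q)).
    exact: for_state_counter.
  by apply/setP => y; rewrite !inE ltnS leq_eqVlt -val_eqE.
rewrite (_ : setT = [set y : 'I_n | (y < n)%N]).
  by rewrite /= sn; apply: Jst.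
by apply/setP => y; rewrite !inE ltn_ord.
Qed.

Lemma nested_for_ind (n : nat) (J : nat -> state R -> Prop) xs p t s :
  well_formed (foldr PFor p xs) ->
  (forall x i v s', x \in xs -> J i s' -> J i (iset x 0 v s')) ->
  (forall i s', J i s' -> imem s' size_reg 0 = n) ->
  (forall i s', J i s' -> J i.+1 (run p s')) ->
  J t s -> J (t + n ^ size xs)%N (run (foldr PFor p xs) s).
Proof.
elim: xs t s => [|x xs IHxs] t s wf Jx Jn Jp Jt.
  by rewrite addn1; apply: Jp.
rewrite /= expnS -[X in (X * _)%N]card_ord -cardsT.
pose K (A : {set 'I_n}) := J (t + #|A| * n ^ size xs)%N.
apply: (@for_ind n K) => //; first exact: Jn Jt.
- by move=> A v s'; apply: Jx; rewrite mem_head.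
- by rewrite /K cards0 addn0.
move=> i A s' iA _ _ JA; rewrite /K cardsU1 iA mulSn addnCA addnC.
apply: IHxs => //; first by have /and3P[] := wf.
by move=> y j v s'' yxs; apply: Jx; rewrite inE yxs orbT.
Qed.

End Run.
Arguments run : simpl never.

(** * Neighbourhoods and separators *)

Section Neighbourhoods.
Variables (T : finType) (G : sgraph T).
Implicit Types (A B D S X Y : {set T}) (u v x y : T).

Definition closed_nbhd X : {set T} :=
  [set y | (y \in X) || [exists x in X, G x y]].

Definition boundary X : {set T} := closed_nbhd X :\: X.

Lemma closed_nbhdP X y :
  reflect (exists2 x, x \in X & (y == x) || G x y) (y \in closed_nbhd X).
Proof.
rewrite inE; apply: (iffP orP) => [[yX|/existsP[x /andP[xX Gxy]]]|[x xX]].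
- by exists y; rewrite ?eqxx.
- by exists x; rewrite ?Gxy ?orbT.
case/predU1P=> [->|Gxy]; [by left | right].
by apply/existsP; exists x; rewrite xX.
Qed.

Lemma in_closed_nbhd1 x y : (y \in closed_nbhd [set x]) = (y == x) || G x y.
Proof.
by apply/closed_nbhdP/idP => [[z /set1P->]|xy] //; exists x; rewrite ?inE.
Qed.

Lemma closed_nbhd1C x y :
  (y \in closed_nbhd [set x]) = (x \in closed_nbhd [set y]).
Proof. by rewrite !in_closed_nbhd1 eq_sym adj_sym. Qed.

Lemma subset_closed_nbhd X : X \subset closed_nbhd X.
Proof. by apply/subsetP => x xX; rewrite inE xX. Qed.

Lemma closed_nbhd0 : closed_nbhd set0 = set0.
Proof.
by apply/setP => y; rewrite [RHS]inE; apply/closed_nbhdP => -[x]; rewrite inE.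
Qed.

Lemma closed_nbhdU X Y :
  closed_nbhd (X :|: Y) = closed_nbhd X :|: closed_nbhd Y.
Proof.
apply/setP => y; rewrite in_setU.
apply/closed_nbhdP/orP => [[x /setUP[xX|xY] xy]|[]/closed_nbhdP[x xX xy]].
- by left; apply/closed_nbhdP; exists x.
- by right; apply/closed_nbhdP; exists x.
- by exists x; rewrite // inE xX.
- by exists x; rewrite // inE xX orbT.
Qed.

Lemma closed_nbhdS X Y : X \subset Y -> closed_nbhd X \subset closed_nbhd Y.
Proof. by move/setUidPr <-; rewrite closed_nbhdU subsetUl. Qed.

Lemma induced_connect_sym D : connect_sym (induced G D).
Proof.
apply: sym_connect_sym => x y; rewrite /induced /= adj_sym.
by rewrite andbA [(x \in D) && _]andbC -andbA.
Qed.

Lemma connect_inducedS A B x y : A \subset B ->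
  connect (induced G A) x y -> connect (induced G B) x y.
Proof.
move=> /subsetP AB; apply: connect_sub => a b /and3P[aA bA Gab].
by apply: connect1; rewrite /induced /= !AB.
Qed.

Lemma disconnected_separator S a b : a \notin S -> b \notin S ->
  ~~ connect (induced G (~: S)) a b -> node_separator G S.
Proof.
move=> aS bS; set e := induced G (~: S) => ab.
have closedS : closed e (~: S) by move=> x y /and3P[-> ->].
rewrite /node_separator /n_comp_mem -/e.
apply: leq_trans (_ : #|pred2 (fingraph.root e a) (fingraph.root e b)| <= _)%N.
  by rewrite card2 root_connect ?ab //; apply: induced_connect_sym.
have root_in c : c \notin S -> fingraph.root e c \in [predI roots e & ~: S].
  move=> cS; apply/andP; split; first exact/roots_root/induced_connect_sym.
  by rewrite -(closed_connect closedS (connect_root e c)) inE.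
apply/subset_leq_card/subsetP => x; rewrite inE.
by case/pred2P=> ->; apply: root_in.
Qed.

Lemma boundary_separator A a b :
  a \in A -> b \notin closed_nbhd A -> node_separator G (boundary A).
Proof.
move=> aA bA; have bA' := contraNN (subsetP (subset_closed_nbhd A) b) bA.
have closedA : closed (induced G (~: boundary A)) A.
  apply: intro_closed; first exact: induced_connect_sym.
  move=> x y /and3P[_ + Gxy] xA; rewrite !inE negb_and negbK => /orP[//|].
  apply: contraNT => _; apply/orP; right.
  by apply/existsP; exists x; rewrite xA.
apply: (@disconnected_separator _ a b).
- by rewrite inE aA.
- by rewrite inE negb_and bA orbT.
- by apply: contraNN bA' => /(closed_connect closedA) <-.
Qed.

Lemma card_separated_graph S : node_separator G S -> (1 < #|T|)%N.
Proof. by move=> sepS; apply: leq_trans sepS (max_card _). Qed.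

Lemma card_closed_nbhd_gt1 v : graph_connected G -> (1 < #|T|)%N ->
  (1 < #|closed_nbhd [set v]|)%N.
Proof.
move=> [_ conG]; rewrite -cardsT (cardsD1 v) inE ltnS => /card_gt0P[u].
rewrite !inE andbT => uv.
have /connectP[p] := conG v u (in_setT _) (in_setT _).
case: p => [_ uE|y p /= /andP[/and3P[_ _ Gvy] _] _].
  by rewrite uE eqxx in uv.
apply: leq_trans (_ : #|[set v; y]| <= _)%N.
  by rewrite cards2; case: eqVneq Gvy => // <-; rewrite adj_irr.
apply/subset_leq_card/subsetP => z; rewrite in_closed_nbhd1 !inE.
by case/orP=> /eqP->; rewrite ?eqxx ?Gvy ?orbT.
Qed.

End Neighbourhoods.

Section Capacities.
Variables (T : finType) (G : sgraph T) (R : realType) (cap : T -> R).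
Hypothesis cap_ge0 : forall v, 0 <= cap v.
Implicit Types (A B S : {set T}) (k r : R).

Lemma capacityS A B : A \subset B -> capacity cap A <= capacity cap B.
Proof.
move=> /subsetP AB; rewrite /capacity [leLHS]big_mkcond [leRHS]big_mkcond.
by apply: ler_sum => v _; case: ifP => [/AB->|_] //; case: ifP.
Qed.

Definition separator_bound k : Prop :=
  (forall S, node_separator G S -> k <= capacity cap S) /\
  k <= capacity cap setT.

Lemma separator_bound_closed_nbhd k v : separator_bound k ->
  k <= capacity cap (closed_nbhd G [set v]).
Proof.
move=> [k_sep k_all]; have [->//|] := eqVneq (closed_nbhd G [set v]) setT.
rewrite -subTset => /subsetPn[b _ bv].
apply: le_trans (k_sep _ (boundary_separator (set11 v) bv)) _.
exact/capacityS/subsetDl.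
Qed.

Lemma cap_eq0_or_gt0 v : cap v = 0 \/ 0 < cap v.
Proof. by have := cap_ge0 v; rewrite le0r => /predU1P. Qed.

Definition potential (w : T -> R) : R := \sum_v cap v * w v.

Definition positive_weight (w : T -> R) : Prop :=
  forall v, 0 < cap v -> 0 < w v.

Lemma potential_ge0 w : positive_weight w -> 0 <= potential w.
Proof.
move=> w_gt0; apply: sumr_ge0 => v _.
by have [->|cv] := cap_eq0_or_gt0 v; rewrite ?mul0r // ltW ?mulr_gt0 ?w_gt0.
Qed.

Lemma le_potential w v : positive_weight w -> cap v * w v <= potential w.
Proof.
move=> w_gt0; rewrite /potential (bigD1 v) //= lerDl; apply: sumr_ge0 => u _.
by have [->|cu] := cap_eq0_or_gt0 u; rewrite ?mul0r // ltW ?mulr_gt0 ?w_gt0.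
Qed.

Lemma potential_gt0 w :
  positive_weight w -> 0 < capacity cap setT -> 0 < potential w.
Proof.
move=> w_gt0; rewrite /capacity => cap_gt0.
have [v cv|cap_le0] := pickP [pred v | 0 < cap v].
  by apply: lt_le_trans (le_potential v w_gt0) => /=; rewrite mulr_gt0 ?w_gt0.
have : \sum_(v in [set: T]) cap v <= 0.
  by apply: sumr_le0 => v _; rewrite leNgt; apply/negPf/cap_le0.
by rewrite leNgt cap_gt0.
Qed.

(* Double counting of the pairs (c, v) with v \in S c. *)
Lemma capacity_count (I : {set T}) (S : T -> {set T}) (w : T -> R) k r b :
  0 <= r -> (forall c, c \in I -> k <= capacity cap (S c)) ->
  (forall v, 0 < cap v -> r * #|[set c in I | v \in S c]|%:R <= b * w v) ->
  k * #|I|%:R * r <= b * potential w.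
Proof.
move=> r_ge0 kS count.
have : k * #|I|%:R <= \sum_v cap v * #|[set c in I | v \in S c]|%:R.
  rewrite mulr_natr -sumr_const; apply: le_trans (ler_sum _ kS) _.
  rewrite /capacity (exchange_big_dep predT) //=; apply: ler_sum => v _.
  rewrite mulr_natr sumr_const (@eq_card _ _ [set c in I | v \in S c]) // => c.
  by rewrite !inE.
move=> /(ler_wpM2r r_ge0) kI; apply: le_trans kI _.
rewrite mulr_suml mulr_sumr; apply: ler_sum => v _; rewrite -mulrA.
have [->|cv] := cap_eq0_or_gt0 v.
  by rewrite !mul0r mulr0.
by rewrite [leRHS]mulrCA ler_pM2l // mulrC count.
Qed.

End Capacities.

(** * Pieces and their labels *)

Section Labels.
Variables (T : finType) (G : sgraph T).
Implicit Types (A D X Y : {set T}) (L : T -> option T) (u v x y c d : T).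

Definition labels L X : {set T} := [set c | [exists y in X, L y == Some c]].

Definition touched L X : {set T} := labels L (closed_nbhd G X).

Lemma labelsP L X c :
  reflect (exists2 y, y \in X & L y = Some c) (c \in labels L X).
Proof.
rewrite inE; apply: (iffP exists_inP) => -[y yX Ly]; exists y => //.
  exact/eqP.
exact/eqP.
Qed.

Lemma labelsU L X Y : labels L (X :|: Y) = labels L X :|: labels L Y.
Proof.
apply/setP => c; rewrite in_setU; apply/labelsP/orP.
  by case=> y /setUP[yX|yY] Ly; [left|right]; apply/labelsP; exists y.
by case=> /labelsP[y yX Ly]; exists y; rewrite // inE yX ?orbT.
Qed.

Lemma labelsS L X Y : X \subset Y -> labels L X \subset labels L Y.
Proof. by move/setUidPr <-; rewrite labelsU subsetUl. Qed.

Lemma labels0 L : labels L set0 = set0.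
Proof.
by apply/setP => c; rewrite [RHS]inE; apply/labelsP => -[y]; rewrite inE.
Qed.

Lemma labels1 L x :
  labels L [set x] = if L x is Some c then [set c] else set0.
Proof.
apply/setP => c; apply/labelsP/idP => [[y /set1P->] ->|]; first exact: set11.
by case Lx: (L x) => [d|]; rewrite inE // => /eqP->; exists x; rewrite ?inE.
Qed.

Lemma touchedU L X Y : touched L (X :|: Y) = touched L X :|: touched L Y.
Proof. by rewrite /touched closed_nbhdU labelsU. Qed.

Lemma touchedS L X Y : X \subset Y -> touched L X \subset touched L Y.
Proof. by move=> XY; apply/labelsS/closed_nbhdS. Qed.

Lemma touched1P L u c : reflect
  (exists2 y, y \in closed_nbhd G [set u] & L y = Some c)
  (c \in touched L [set u]).
Proof. exact: labelsP. Qed.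

Lemma touched_sub L X : touched L X \subset labels L setT.
Proof. exact/labelsS/subsetT. Qed.

(* The pieces are the components of G[D], labelled by an element of D, and the
   undominated vertices, labelled by themselves; dominated vertices outside D
   carry no label. *)
Record labelling D L : Prop := Labelling {
  label_in : forall x, x \in D -> exists2 c, c \in D & L x = Some c;
  label_out : forall x, x \notin D ->
    L x = if x \in closed_nbhd G D then None else Some x;
  label_eq : {in D &, forall x y, (L x == L y) = connect (induced G D) x y} }.

Lemma labelling0 : labelling set0 (@Some T).
Proof. by split=> [x|x _|x y]; rewrite ?closed_nbhd0 inE. Qed.

Section Labelling.
Variables (D : {set T}) (L : T -> option T).
Hypothesis lab : labelling D L.

Lemma label_self x c : x \notin D -> L x = Some c -> c = x.
Proof. by move/(label_out lab)->; case: ifP => // _ [->]. Qed.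

Lemma label_mem x c : L x = Some c -> (c \in D) = (x \in D).
Proof.
case: (boolP (x \in D)) => xD Lx.
  by have [d dD] := label_in lab xD; rewrite Lx => -[->].
by rewrite (label_self xD Lx) (negPf xD).
Qed.

Lemma label_adj x y c d : L x = Some c -> L y = Some d -> G x y ->
  (x \in D) || (y \in D) -> c = d.
Proof.
wlog xD : x y c d / x \in D => [wlog_xD Lx Ly Gxy|Lx Ly Gxy _].
  case/orP=> [xD|yD]; first by apply: (wlog_xD x y); rewrite ?xD.
  by apply/esym/(wlog_xD y x); rewrite ?yD // adj_sym.
have yN : y \in closed_nbhd G D.
  by apply/closed_nbhdP; exists x; rewrite ?Gxy ?orbT.
case: (boolP (y \in D)) => yD; last by rewrite (label_out lab yD) yN in Ly.
have /eqP : L x == L y.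
  by rewrite (label_eq lab) //; apply: connect1; rewrite /induced /= xD yD.
by rewrite Lx Ly => -[].
Qed.

Lemma touched1_neq0 v : touched L [set v] != set0.
Proof.
suff [y vy [c Ly]] : exists2 y, y \in closed_nbhd G [set v] &
    exists c, L y = Some c.
  by apply/set0Pn; exists c; apply/touched1P; exists y.
have vv : v \in closed_nbhd G [set v] by rewrite in_closed_nbhd1 eqxx.
case: (boolP (v \in D)) => vD.
  by have [c _ Lv] := label_in lab vD; exists v => //; exists c.
have := label_out lab vD; case: ifP => [/closed_nbhdP[y yD yv] _|_ Lv].
  have [c _ Ly] := label_in lab yD; exists y; last by exists c.
  by rewrite closed_nbhd1C in_closed_nbhd1.
by exists v => //; exists v.
Qed.

Lemma card_touched1_gt0 v : (0 < #|touched L [set v]|)%N.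
Proof. by rewrite card_gt0 touched1_neq0. Qed.

End Labelling.

Definition star X v : bool := (v \in X) && (X \subset closed_nbhd G [set v]).

Definition merge_label D L X v x : option T :=
  if x \in X then Some v else
  if L x is Some c then
    if c \in touched L X then (if x \in D then Some v else None) else Some c
  else None.

Lemma card_merge_labels D X L v :
  (#|labels (merge_label D L X v) setT| + #|touched L X| <=
     #|labels L setT| + 1)%N.
Proof.
have : labels (merge_label D L X v) setT \subset
    v |: (labels L setT :\: touched L X).
  apply/subsetP => c /labelsP[x _]; rewrite /merge_label !inE.
  case: ifP => [_ [->]|_]; first by rewrite eqxx.
  case Lx: (L x) => [d|//]; case: ifP => [_|dX].
    by case: ifP => // _ [->]; rewrite eqxx.
  move=> -[<-]; rewrite inE in dX; rewrite dX /=; apply/orP; right.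
  by apply/existsP; exists x; rewrite inE Lx /=.
move/subset_leq_card; have := cardsID (touched L X) (labels L setT).
rewrite (setIidPr (touched_sub L X)) cardsU1 => <-; case: (_ \notin _); lia.
Qed.

Section Merge.
Variables (D X : {set T}) (L : T -> option T) (v : T).
Hypotheses (lab : labelling D L) (starX : star X v) (XD : [disjoint X & D]).
Local Notation L' := (merge_label D L X v).

Let center_in : v \in X. Proof. by case/andP: starX. Qed.

Let notD u : u \in X -> u \notin D.
Proof. by move=> uX; rewrite (disjointFr XD uX). Qed.

Lemma merge_label_in x :
  x \in D :|: X -> exists2 c, c \in D :|: X & L' x = Some c.
Proof.
have vDX : v \in D :|: X by rewrite inE center_in orbT.
rewrite inE /merge_label; case: ifP => [xX _|_]; first by exists v.
rewrite orbF => xD; have [c cD ->] := label_in lab xD; rewrite xD.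
by case: ifP => _; [exists v | exists c => //; rewrite inE cD].
Qed.

Lemma merge_label_out x : x \notin D :|: X ->
  L' x = if x \in closed_nbhd G (D :|: X) then None else Some x.
Proof.
rewrite inE negb_or closed_nbhdU inE => /andP[xD xX].
rewrite /merge_label (negPf xX) (label_out lab xD) (negPf xD).
case: (boolP (x \in closed_nbhd G D)) => //= xND.
suff -> : (x \in touched L X) = (x \in closed_nbhd G X) by [].
apply/labelsP/idP => [[y yX Ly]|xX']; last first.
  by exists x; rewrite // (label_out lab xD) (negPf xND).
have yD : y \notin D by rewrite -(label_mem lab Ly).
by rewrite (label_self lab yD Ly).
Qed.

Lemma merge_label_center_connect x : x \in D :|: X -> L' x = Some v ->
  connect (induced G (D :|: X)) x v.
Proof.
have connX u : u \in X -> connect (induced G (D :|: X)) u v.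
  move=> uX; have /andP[_ /subsetP/(_ u uX)] := starX.
  rewrite in_closed_nbhd1 => /predU1P[->|Gvu]; first exact: connect0.
  by apply: connect1; rewrite /induced /= !inE uX center_in !orbT adj_sym.
rewrite inE /merge_label; case: ifP => [xX _ _|_]; first exact: connX.
rewrite orbF => xD; have [c cD Lx] := label_in lab xD; rewrite Lx xD.
case: ifP => [/labelsP[y /closed_nbhdP[u uX uy] Ly] _|_ [cv]]; last first.
  by move: cD; rewrite cv (negPf (notD center_in)).
have yD : y \in D by rewrite -(label_mem lab Ly).
have uE : (y == u) = false by apply: contraNF (notD uX) => /eqP <-.
apply: connect_trans (connX u uX); apply: (@connect_trans _ _ y).
  apply: (connect_inducedS (subsetUl _ _)).
  by rewrite -(label_eq lab) // Lx Ly.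
rewrite uE in uy; apply: connect1.
by rewrite /induced /= !inE yD uX orbT adj_sym.
Qed.

Lemma merge_label_connect x y : x \in D :|: X -> y \in D :|: X ->
  L' x = L' y -> connect (induced G (D :|: X)) x y.
Proof.
move=> xDX yDX Lxy; have [Lxv|Lxv] := eqVneq (L' x) (Some v).
  apply: connect_trans (merge_label_center_connect xDX Lxv) _.
  rewrite induced_connect_sym; apply: merge_label_center_connect => //.
  by rewrite -Lxy.
have oldE z : z \in D :|: X -> L' z != Some v -> z \in D /\ L' z = L z.
  rewrite inE /merge_label; case: ifP; rewrite ?eqxx // orbF => _ zD.
  by case: (L z) => [c|] //; rewrite zD; case: ifP; rewrite ?eqxx.
have [xD Lx] := oldE x xDX Lxv.
have [yD Ly] : y \in D /\ L' y = L y by apply: oldE; rewrite -?Lxy.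
apply: (connect_inducedS (subsetUl _ _)).
by rewrite -(label_eq lab) // -Lx -Ly Lxy.
Qed.

Lemma merge_label_adj x y : x \in D :|: X -> y \in D :|: X -> G x y ->
  L' x = L' y.
Proof.
have LX z : z \in X -> L' z = Some v by rewrite /merge_label => ->.
have LDX z u : z \in X -> u \in D -> G z u -> L' u = Some v.
  move=> zX uD Gzu; have [c _ Lu] := label_in lab uD.
  rewrite /merge_label Lu uD; case: ifP => // _; case: ifP => // /negP[].
  apply/labelsP; exists u => //.
  by apply/closed_nbhdP; exists z; rewrite ?Gzu ?orbT.
move=> /setUP[xD|xX] /setUP[yD|yX] Gxy; last by rewrite !LX.
- have [c _ Lx] := label_in lab xD; have [d _ Ly] := label_in lab yD.
  have cd : c = d by apply: (label_adj lab Lx Ly Gxy); rewrite xD.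
  rewrite /merge_label Lx Ly xD yD cd.
  by rewrite !(contraTF (@notD _)).
- by rewrite (LX y) // (LDX y) // adj_sym.
- by rewrite (LX x) // (LDX x).
Qed.

Lemma merge_labelling : labelling (D :|: X) L'.
Proof.
split=> [||x y xDX yDX]; [exact: merge_label_in|exact: merge_label_out|].
apply/eqP/idP => [|conn]; first exact: merge_label_connect.
have L'_closed : closed (induced G (D :|: X)) [pred z | L' z == L' x].
  by move=> z u /and3P[zDX uDX Gzu]; rewrite !inE (merge_label_adj _ _ Gzu).
by have := closed_connect L'_closed conn; rewrite !inE eqxx => /esym/eqP.
Qed.

End Merge.
End Labels.

(** * Cheap spiders from separators *)

Section Spiders.
Variables (T : finType) (G : sgraph T) (R : realType) (cap w : T -> R).
Hypothesis cap_ge0 : forall v, 0 <= cap v.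
Hypothesis w_gt0 : positive_weight cap w.
Implicit Types (D X : {set T}) (L : T -> option T) (r t k : R) (u v c : T).

Definition light D r : {set T} := [set u in ~: D | (0 < cap u) && (w u <= r)].

Definition legs D r v : {set T} := [set u in light D r | G v u].

Definition reach D L r v : {set T} := touched G L (v |: legs D r v).

Definition spider_cost D L r v : R :=
  w v + r * (#|reach D L r v|%:R - #|touched G L [set v]|%:R).

Definition spider_ratio D L r v : R :=
  spider_cost D L r v / (#|reach D L r v|%:R - 1).

Definition candidate D L t v : bool :=
  [&& v \notin D, 0 < cap v & (1 < #|reach D L t v|)%N].

Lemma touched_reach D L r v : touched G L [set v] \subset reach D L r v.
Proof. exact/touchedS/subsetUl. Qed.

Lemma card_touched_reach D L r v :
  #|touched G L [set v]|%:R <= #|reach D L r v|%:R :> R.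
Proof. by rewrite ler_nat subset_leq_card ?touched_reach. Qed.

Lemma lightP D r u :
  reflect [/\ u \notin D, 0 < cap u & w u <= r] (u \in light D r).
Proof.
by rewrite inE in_setC; apply: (iffP and3P) => -[uD cu wu]; split.
Qed.

Lemma mem_reach D L r v y z c : y \in light D r -> G v y ->
  z \in closed_nbhd G [set y] -> L z = Some c -> c \in reach D L r v.
Proof.
move=> ly Gvy zy Lz; apply/labelsP; exists z => //.
apply: (subsetP (closed_nbhdS G _)) zy.
by rewrite sub1set; apply/setU1P; right; apply/setIdP.
Qed.

Section CostlySpiders.
Variables (D : {set T}) (L : T -> option T) (k r : R).
Hypothesis conG : graph_connected G.
Hypothesis k_sep : separator_bound G cap k.
Hypothesis r_gt0 : 0 < r.
Hypotheses (lab : labelling G D L) (pieces_gt1 : (1 < #|labels L setT|)%N).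
Hypothesis costly : forall v, v \notin D -> 0 < cap v ->
  2 * r * (#|reach D L r v|%:R - 1) < spider_cost D L r v.

Let card_touched1_ge1 v : 1 <= #|touched G L [set v]|%:R :> R.
Proof. by rewrite ler1n (card_touched1_gt0 lab). Qed.

Lemma costly_weight v : v \notin D -> 0 < cap v ->
  r * (#|reach D L r v|%:R + #|touched G L [set v]|%:R - 2) < w v.
Proof. by move=> vD /(costly vD); rewrite /spider_cost; lra. Qed.

Lemma reach_light_single u :
  u \in light D r -> exists c, reach D L r u = [set c].
Proof.
case/lightP=> uD cu wu; apply/cards1P.
have := lt_le_trans (costly_weight uD cu) wu.
have := card_touched_reach D L r u; have := card_touched1_ge1 u.
rewrite eqn_leq -ltnS -(ltr_nat R) -(ler_nat R).
move: (#|reach D L r u|%:R : R) (#|touched G L [set u]|%:R : R) => m p.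
rewrite -[X in _ < X]mulr1 ltr_pM2l // => p_ge1 p_le_m few.
by apply/andP; split; lra.
Qed.

Definition piece c : {set T} := [set x | L x == Some c].

Definition enlarged_piece c : {set T} :=
  piece c :|: (light D r :&: closed_nbhd G (piece c)).

Lemma notin_nbhd_enlarged_piece b c d : L b = Some d -> d != c ->
  (b \in D) || (c \in D) -> b \notin closed_nbhd G (enlarged_piece c).
Proof.
move=> Lb dc bcD; apply/closed_nbhdP => -[y].
case/setUP=> [|/setIP[ly /closed_nbhdP[z]]]; rewrite inE => /eqP.
  move=> Ly yb; suff cd : c = d by rewrite cd eqxx in dc.
  case/predU1P: yb => [bE|Gyb]; first by rewrite bE Ly in Lb; case: Lb.
  by apply: (label_adj lab Ly Lb Gyb); rewrite -(label_mem lab Ly) orbC.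
move=> Lz yz by_; have [e reachE] := reach_light_single ly.
have touch_e a f : a \in closed_nbhd G [set y] -> L a = Some f -> f = e.
  move=> ya La; apply/set1P; rewrite -reachE.
  by apply: (subsetP (touched_reach _ _ _ _)); apply/touched1P; exists a.
move: dc; rewrite (touch_e b d) ?in_closed_nbhd1 // (touch_e z c) ?eqxx //.
by rewrite closed_nbhd1C in_closed_nbhd1.
Qed.

Lemma boundary_enlarged_piece_reach v c :
  v \in boundary G (enlarged_piece c) -> c \in reach D L r v.
Proof.
case/setDP=> /closed_nbhdP[y yA vy] vA.
have Gyv : G y v by case/predU1P: vy vA => // ->; rewrite yA.
case/setUP: yA => [|/setIP[ly /closed_nbhdP[z]]]; rewrite inE => /eqP.
  move=> Ly; apply: (subsetP (touched_reach _ _ _ _)); apply/touched1P.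
  by exists y => //; rewrite closed_nbhd1C in_closed_nbhd1 Gyv orbT.
move=> Lz yz; apply: (mem_reach ly) Lz; first by rewrite adj_sym.
by rewrite closed_nbhd1C in_closed_nbhd1.
Qed.

Lemma light_notin_boundary v c :
  v \in light D r -> v \notin boundary G (enlarged_piece c).
Proof.
move=> lv; apply/negP => vB; have := boundary_enlarged_piece_reach vB.
have [d reachE] := reach_light_single lv.
have /set0Pn[e ve] := touched1_neq0 lab v.
have := subsetP (touched_reach D L r v) e ve; rewrite reachE => /set1P ed.
rewrite ed in ve => /set1P cd; rewrite -cd in ve.
case/touched1P: ve => y yv Ly; case/setDP: vB => _ /negP[].
apply/setUP; right; apply/setIP; split=> //.
apply/closed_nbhdP; exists y; first by rewrite inE Ly.
by rewrite -in_closed_nbhd1 closed_nbhd1C.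
Qed.

Lemma member_notin_boundary v c :
  v \in D -> v \notin boundary G (enlarged_piece c).
Proof.
move=> vD; apply/negP => /setDP[vN vA]; have [d _ Lv] := label_in lab vD.
have dc : d != c by apply: contraNneq vA => <-; rewrite !inE Lv eqxx.
by have := notin_nbhd_enlarged_piece Lv dc; rewrite vD vN => /(_ isT).
Qed.

Lemma separator_bound_enlarged_piece c : D != set0 -> c \in labels L setT ->
  k <= capacity cap (boundary G (enlarged_piece c)).
Proof.
move=> /set0Pn[x xD] cL; have [a _ La] := labelsP _ _ _ cL.
suff [b [d [Lb dc bcD]]] :
    exists b d, [/\ L b = Some d, d != c & (b \in D) || (c \in D)].
  apply: (proj1 k_sep); apply: (@boundary_separator _ _ _ a b).
    by rewrite !inE La eqxx.
  exact: notin_nbhd_enlarged_piece Lb dc bcD.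
case: (boolP (c \in D)) => cD.
  move: pieces_gt1; rewrite (cardsD1 c) cL ltnS => /card_gt0P[d].
  by case/setD1P=> dc /labelsP[b _ Lb]; exists b, d; rewrite orbT.
have [d dD Lx] := label_in lab xD; exists x, d; rewrite xD; split=> //.
by apply: contraNneq cD => <-.
Qed.

Lemma costly_spiders_nonempty : D != set0 ->
  k * #|labels L setT|%:R * r <= 2 * potential cap w.
Proof.
move=> D0; apply: capacity_count (ltW r_gt0) _ _ => // [c cL|v cv].
  exact: separator_bound_enlarged_piece D0 cL.
case: (boolP ((v \in D) || (v \in light D r))) => [vDl|].
  rewrite [X in X%:R](_ : _ = 0%N) ?mulr0 ?mulr_ge0 ?ltW ?w_gt0 //.
  apply: eq_card0 => c; rewrite inE; apply/negP => /andP[_].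
  by case/orP: vDl => [vD|vl]; apply/negP;
    [exact: member_notin_boundary | exact: light_notin_boundary].
rewrite negb_or => /andP[vD vl].
have r_lt_w : r < w v by rewrite ltNge; apply: contraNN vl => wv; apply/lightP.
have : #|[set c in labels L setT | v \in boundary G (enlarged_piece c)]|%:R
    <= #|reach D L r v|%:R :> R.
  rewrite ler_nat; apply/subset_leq_card/subsetP => c; rewrite inE => /andP[_].
  exact: boundary_enlarged_piece_reach.
have := costly_weight vD cv; have := card_touched1_ge1 v.
move: (#|reach D L r v|%:R : R) (#|touched G L [set v]|%:R : R) (#|_|%:R : R).
by move: r_gt0 => r0 m p q p1 lt qm; nra.
Qed.

Lemma costly_spiders_empty : D = set0 ->
  k * #|labels L setT|%:R * r <= potential cap w.
Proof.
move=> D0; rewrite -[leRHS]mul1r.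
have LE x : L x = Some x by rewrite (label_out lab) D0 ?closed_nbhd0 inE.
have touchedE v : touched G L [set v] = closed_nbhd G [set v].
  apply/setP => c; apply/touched1P/idP => [[y yv]|cv]; last by exists c.
  by rewrite LE => -[<-].
have T_gt1 : (1 < #|T|)%N by apply: leq_trans pieces_gt1 (max_card _).
pose S c := closed_nbhd G [set c].
apply: (capacity_count cap_ge0 (S := S)) (ltW r_gt0) _ _ => [c _|v cv].
  exact: separator_bound_closed_nbhd.
rewrite mul1r.
have -> : #|[set c in labels L setT | v \in closed_nbhd G [set c]]| =
    #|touched G L [set v]|.
  rewrite touchedE; apply: eq_card => c; rewrite [LHS]inE closed_nbhd1C.
  by rewrite andb_idl // => _; apply/labelsP; exists c.
have vD : v \notin D by rewrite D0 inE.
have : 2 <= #|touched G L [set v]|%:R :> R.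
  by rewrite ler_nat touchedE card_closed_nbhd_gt1.
have := costly_weight vD cv; have := card_touched_reach D L r v.
move: (#|reach D L r v|%:R : R) (#|touched G L [set v]|%:R : R) => m p.
by move: r_gt0 => r0 pm lt p2; nra.
Qed.

End CostlySpiders.

Lemma exists_cheap_spider D L k r : graph_connected G ->
  separator_bound G cap k -> 0 < r ->
  labelling G D L -> (1 < #|labels L setT|)%N ->
  2 * potential cap w < k * #|labels L setT|%:R * r ->
  exists v, [/\ v \notin D, 0 < cap v &
    spider_cost D L r v <= 2 * r * (#|reach D L r v|%:R - 1)].
Proof.
move=> conG k_sep r_gt0 lab pieces_gt1 large.
case: (pickP [pred v | [&& v \notin D, 0 < cap v &
    spider_cost D L r v <= 2 * r * (#|reach D L r v|%:R - 1)]]).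
  by move=> v /and3P[vD cv cheap]; exists v.
move=> none; exfalso.
have costly v : v \notin D -> 0 < cap v ->
    2 * r * (#|reach D L r v|%:R - 1) < spider_cost D L r v.
  by move=> vD cv; have := none v; rewrite /= vD cv /= ltNge => ->.
have Phi_ge0 := potential_ge0 cap_ge0 w_gt0.
have [D0|D0] := eqVneq D set0.
  have := costly_spiders_empty conG k_sep r_gt0 lab pieces_gt1 costly D0; lra.
have := costly_spiders_nonempty k_sep r_gt0 lab pieces_gt1 costly D0; lra.
Qed.

(* Only these thresholds matter: lowering r to the weight of the heaviest leg,
   or to 0 if there is no leg, does not change the spider. *)
Definition threshold v u : R := if u == v then 0 else w u.

Lemma reach_threshold D L r v : 0 < r ->
  exists2 u, threshold v u <= r & reach D L (threshold v u) v = reach D L r v.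
Proof.
move=> r_gt0; suff [u ur legsE] : exists2 u, threshold v u <= r &
    legs D (threshold v u) v = legs D r v by exists u; rewrite // /reach legsE.
have [no_legs|[x xlegs]] := set_0Vmem (legs D r v).
  exists v; rewrite /threshold eqxx ?ltW // no_legs.
  apply/setP => u; rewrite [RHS]inE; apply/negP => /setIdP[/lightP[_ cu]].
  by rewrite leNgt w_gt0.
case: (arg_maxP w xlegs) => u /setIdP[/lightP[uD cu wu] Gvu] u_max.
have uv : (u == v) = false by apply: contraTF Gvu => /eqP->; rewrite adj_irr.
exists u; rewrite /threshold uv //; apply/setP => y.
apply/idP/idP => [/setIdP[/lightP[yD cy wy] Gvy]|ylegs].
  by rewrite inE Gvy andbT; apply/lightP; split=> //; apply: le_trans wy wu.
have /setIdP[/lightP[yD cy _] Gvy] := ylegs.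
by rewrite inE Gvy andbT; apply/lightP; split=> //; apply: u_max.
Qed.

Lemma cheap_spider D L k : graph_connected G ->
  separator_bound G cap k -> 0 < k ->
  labelling G D L -> (1 < #|labels L setT|)%N ->
  exists v u, candidate D L (threshold v u) v /\
    spider_ratio D L (threshold v u) v <=
      6 * potential cap w / (k * #|labels L setT|%:R).
Proof.
move=> conG k_sep k_gt0 lab pieces_gt1; set q : R := #|labels L setT|%:R.
have kq_gt0 : 0 < k * q by rewrite mulr_gt0 ?ltr0n ?(ltnW pieces_gt1).
have Phi_gt0 : 0 < potential cap w.
  by apply: potential_gt0; rewrite ?(lt_le_trans k_gt0 (proj2 k_sep)).
pose r := 3 * potential cap w / (k * q).
have r_gt0 : 0 < r by apply: divr_gt0 => //; apply: mulr_gt0.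
have [|v [vD cv]] := exists_cheap_spider conG k_sep r_gt0 lab pieces_gt1.
  by rewrite -/q [ltRHS]mulrC /r divfK ?gt_eqF //; lra.
have [u] := reach_threshold D L v r_gt0.
set t := threshold v u => t_le_r reachE; rewrite /spider_cost -reachE => cheap.
have wv := w_gt0 cv; have p_le_m := card_touched_reach D L t v.
have p_ge1 : 1 <= #|touched G L [set v]|%:R :> R.
  by rewrite ler1n (card_touched1_gt0 lab).
have m_gt1 : 1 < #|reach D L t v|%:R :> R.
  have : 0 < r * (#|reach D L t v|%:R + #|touched G L [set v]|%:R - 2) by lra.
  by rewrite pmulr_rgt0 //; lra.
exists v, u; split; first by rewrite /candidate vD cv -(ltr1n R).
have -> : 6 * potential cap w / (k * q) = 2 * r by rewrite /r; lra.
rewrite /spider_ratio ler_pdivrMr ?subr_gt0 //; apply: le_trans cheap.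
by rewrite lerD2l ler_wpM2r // subr_ge0.
Qed.

End Spiders.

(** * The greedy connected dominating set *)

Section PartialSpiders.
Variables (T : finType) (G : sgraph T) (R : realType) (cap w : T -> R).
Hypothesis w_gt0 : positive_weight cap w.
Implicit Types (D X A : {set T}) (L : T -> option T) (t : R) (u v : T).
Local Notation legs := (legs G cap w).
Local Notation reach := (reach G cap w).
Local Notation candidate := (candidate G cap w).

Definition spider D L t v X : Prop :=
  [/\ star G X v, [disjoint X & D], {in X, forall u, 0 < cap u},
      touched G L X = reach D L t v &
      \sum_(u in X) w u <= spider_cost G cap w D L t v].

Definition partial_spider L t v A X : Prop :=
  [/\ v \in X, X \subset v |: A, touched G L X = touched G L (v |: A) &
      \sum_(u in X) w u <= w v + t *
        (#|touched G L (v |: A)|%:R - #|touched G L [set v]|%:R)].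

Lemma partial_spider0 L t v : partial_spider L t v set0 [set v].
Proof.
split; rewrite ?set11 ?setU0 ?subxx //.
by rewrite big_set1 subrr mulr0 addr0.
Qed.

Lemma partial_spider_skip L t v A X u :
  touched G L [set u] \subset touched G L (v |: A) ->
  partial_spider L t v A X -> partial_spider L t v (u |: A) X.
Proof.
move=> /setUidPr touch_u [vX XA touchX cost]; split=> //.
- by apply: subset_trans XA _; rewrite setUS // subsetUr.
- by rewrite touchX setUCA (touchedU _ _ [set u]) touch_u.
by rewrite setUCA (touchedU _ _ [set u]) touch_u.
Qed.

Lemma partial_spider_add D L t v A X u : u \in legs D t v -> u \notin A ->
  ~~ (touched G L [set u] \subset touched G L (v |: A)) ->
  partial_spider L t v A X -> partial_spider L t v (u |: A) (u |: X).
Proof.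
move=> /setIdP[/lightP[_ cu wu] Gvu] uA new_label [vX XA touchX cost].
have uX : u \notin X.
  apply: contraNN uA => /(subsetP XA)/setU1P[uv|//].
  by rewrite uv adj_irr in Gvu.
have t_ge0 : 0 <= t by apply: le_trans wu; apply/ltW/w_gt0.
split; first by rewrite inE vX orbT.
- by rewrite setUCA setUS.
- by rewrite setUCA !(touchedU _ _ [set u]) touchX.
rewrite big_setU1 //= setUCA (touchedU _ _ [set u]).
set M := touched G L (v |: A) in new_label cost *.
have : #|M|%:R + 1 <= #|touched G L [set u] :|: M|%:R :> R.
  rewrite natr1 ler_nat; apply: proper_card; rewrite properE subsetUr.
  by apply: contraNN new_label; apply: subset_trans (subsetUl _ _).
move: (#|_ :|: M|%:R : R) (#|M|%:R : R) cost => m' m cost mm'.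
have : t <= t * (m' - m) by apply: ler_peMr => //; lra.
by move: wu; lra.
Qed.

Lemma partial_spider_full D L t v X : v \notin D -> 0 < cap v ->
  partial_spider L t v (legs D t v) X -> spider D L t v X.
Proof.
move=> vD cv [vX XA touchX cost].
have memX u : u \in X -> u = v \/ u \in legs D t v.
  by move/(subsetP XA)/setU1P.
split=> //.
- apply/andP; split=> //; apply/subsetP => u /memX[->|/setIdP[_ Gvu]].
    by rewrite in_closed_nbhd1 eqxx.
  by rewrite in_closed_nbhd1 Gvu orbT.
- rewrite disjoint_subset; apply/subsetP => u /memX[->//|].
  by case/setIdP=> /lightP[].
- by move=> u /memX[->|/setIdP[/lightP[]]].
Qed.

Inductive greedy_step D L : {set T} -> (T -> option T) -> Prop :=
| GreedyStuck :
    (forall v u, ~~ candidate D L (threshold w v u) v) -> greedy_step D L D L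
| GreedyMerge t v X :
    candidate D L t v -> spider D L t v X ->
    (forall v' u, candidate D L (threshold w v' u) v' ->
       spider_ratio G cap w D L t v <=
         spider_ratio G cap w D L (threshold w v' u) v') ->
    greedy_step D L (D :|: X) (merge_label G D L X v).

End PartialSpiders.

Lemma harmonic_le_ln (R : realType) (p q : R) : 0 < p -> 0 < q ->
  (q - p) / q <= ln q - ln p.
Proof.
move=> p0 q0; rewrite mulrBl divff ?gt_eqF //.
have := @le_ln1Dx R (p / q - 1).
rewrite [1 + _]addrC subrK lnM ?posrE ?invr_gt0 // lnV ?posrE //.
have : 0 < p / q by rewrite divr_gt0.
by move: (p / q) => x x0 /(_ _); lra.
Qed.

Lemma greedy_cost_step (R : realType) (k a b r W W' q q' m : R) :
  0 < k -> 0 <= a -> 0 < q -> 0 < q' -> 1 <= m -> q' + m <= q + 1 ->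
  r <= a / (k * q) -> W' <= W + r * (m - 1) ->
  k * W <= a * (b - ln q) -> k * W' <= a * (b - ln q').
Proof.
move=> k_gt0 a_ge0 q_gt0 q'_gt0 m_ge1 merged r_le cost bound.
have kr : k * r <= a / q.
  have -> : a / q = k * (a / (k * q)) by field; rewrite !gt_eqF.
  by rewrite ler_pM2l.
have kW' : k * W' <= k * W + k * r * (m - 1).
  by rewrite -mulrA -mulrDr ler_pM2l.
have spent : k * r * (m - 1) <= a * ((q - q') / q).
  apply: le_trans (ler_wpM2r _ kr) _; first by lra.
  rewrite mulrAC mulrA; apply: ler_wpM2r; first by rewrite invr_ge0 ltW.
  by apply: ler_wpM2l; lra.
have logs : a * ((q - q') / q) <= a * (ln q - ln q').
  by apply: ler_wpM2l; [lra | exact: harmonic_le_ln].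
by move: kW' spent logs bound; rewrite !mulrBr; lra.
Qed.

Section Greedy.
Variables (T : finType) (G : sgraph T) (R : realType) (cap w : T -> R) (k : R).
Hypothesis conG : graph_connected G.
Hypothesis cap_ge0 : forall v, 0 <= cap v.
Hypothesis w_gt0 : positive_weight cap w.
Implicit Types (D X : {set T}) (L : T -> option T) (i : nat).
Local Notation Phi := (potential cap w).

Definition separable : Prop :=
  [/\ (1 < #|T|)%N, 0 < k & separator_bound G cap k].

Definition greedy_state i D L : Prop :=
  [/\ labelling G D L, {in D, forall x, 0 < cap x} &
      separable ->
        ((#|labels L setT| <= 1) || (#|labels L setT| + i <= #|T|))%N /\
        k * \sum_(x in D) w x <=
          6 * Phi * (ln #|T|%:R - ln #|labels L setT|%:R)].

Lemma card_labels_gt0 D L : labelling G D L -> (0 < #|labels L setT|)%N.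
Proof.
move=> lab; case: conG => /set0Pn[x _] _.
apply: leq_trans (card_touched1_gt0 lab x) _.
exact/subset_leq_card/touched_sub.
Qed.

Lemma greedy_state0 : greedy_state 0 set0 (@Some T).
Proof.
have labelsT : labels (@Some T) setT = setT.
  by apply/setP => x; rewrite [RHS]inE; apply/labelsP; exists x.
rewrite /greedy_state labelsT; split=> [|x|_].
- exact: labelling0.
- by rewrite inE.
by rewrite cardsT addn0 leqnn orbT big_set0 subrr !mulr0.
Qed.

Lemma greedy_state_step i D L D' L' : greedy_state i D L ->
  greedy_step G cap w D L D' L' -> greedy_state i.+1 D' L'.
Proof.
move=> [lab pos sepDL] [stuck|t v X /and3P[_ _ m_gt1] X_spider best].
  split=> // sep; have [_ bound] := sepDL sep; split=> //.
  have [_ k_gt0 k_sep] := sep; rewrite leqNgt; case: leqP => //= q_gt1.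
  have [v [u []]] := cheap_spider cap_ge0 w_gt0 conG k_sep k_gt0 lab q_gt1.
  by rewrite (negPf (stuck v u)).
have [starX XD posX touchX cost] := X_spider.
have lab' := merge_labelling lab starX XD.
have merged := card_merge_labels G D X L v; rewrite touchX in merged.
split=> // [x /setUP[/pos|/posX]//|sep]; have [q_small bound] := sepDL sep.
have [_ k_gt0 k_sep] := sep.
have q_gt1 : (1 < #|labels L setT|)%N.
  by have := card_labels_gt0 lab'; move: merged m_gt1; lia.
split; first by apply/orP; right; move: merged m_gt1 q_small; lia.
have [v' [u [cand cheap]]] :=
  cheap_spider cap_ge0 w_gt0 conG k_sep k_gt0 lab q_gt1.
pose m : R := #|reach G cap w D L t v|%:R.
have m_gt1R : 1 < m by rewrite ltr1n.
have ratio_le := le_trans (best _ _ cand) cheap.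
apply: (greedy_cost_step (m := m)) ratio_le _ bound => //.
- by rewrite mulr_ge0 ?potential_ge0.
- by rewrite ltr0n ltnW.
- by rewrite ltr0n (card_labels_gt0 lab').
- exact: ltW.
- by rewrite natr1 -natrD ler_nat -addn1.
rewrite (eq_bigl _ _ (fun x => in_setU x D X)) bigU /= 1?disjoint_sym //.
by rewrite lerD2l /spider_ratio divfK // gt_eqF // subr_gt0.
Qed.

Lemma greedy_state_final D L : greedy_state #|T| D L -> separable ->
  (#|labels L setT| <= 1)%N /\ k * \sum_(x in D) w x <= 6 * Phi * ln #|T|%:R.
Proof.
move=> [lab _ sepDL] sep; have [q_small bound] := sepDL sep.
have q_gt0 := card_labels_gt0 lab.
have q1 : #|labels L setT| = 1%N by lia.
by rewrite q1 ln1 subr0 in bound *.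
Qed.

Definition conflict D L x y : bool :=
  (L x != None) && ((x \notin D) || (L y != None) && (L x != L y)).

Lemma conflict_free_connected_dominating D L : labelling G D L ->
  (forall x y, ~~ conflict D L x y) -> connected_dominating G D.
Proof.
move=> lab free.
have dominated x : x \notin D -> exists2 y, y \in D & G x y.
  move=> xD; have := free x x; rewrite /conflict xD andbT negbK.
  rewrite (label_out lab xD); case: ifP => // /closed_nbhdP[y yD].
  case/predU1P=> [xy|Gyx _]; first by rewrite xy yD in xD.
  by exists y; rewrite // adj_sym.
split=> //; split=> [|x y xD yD].
  case: conG => /set0Pn[x _] _; apply/set0Pn.
  by case: (boolP (x \in D)) => [xD|/dominated[y yD _]]; [exists x | exists y].
rewrite -(label_eq lab) //; have := free x y; rewrite /conflict xD.
have [c _ ->] := label_in lab xD; have [d _ ->] := label_in lab yD.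
by rewrite /= negbK.
Qed.

Lemma single_label_conflict_free D L x y : (1 < #|T|)%N -> labelling G D L ->
  (#|labels L setT| <= 1)%N -> ~~ conflict D L x y.
Proof.
move=> n_gt1 lab q_le1.
have uniq a b c d : L a = Some c -> L b = Some d -> c = d.
  by move=> La Lb; apply: (card_le1_eqP q_le1);
    apply/labelsP; [exists b | exists a].
rewrite /conflict; case Lx: (L x) => [c|//]; rewrite [_ && _]/= negb_or negbK.
apply/andP; split; last first.
  by case Ly: (L y) => [d|//]; rewrite (uniq _ _ _ _ Lx Ly) eqxx.
apply: contraT => xD; have cx := label_self lab xD Lx.
have [D0|[d dD]] := set_0Vmem D; last first.
  have [e eD Ld] := label_in lab dD.
  by rewrite -cx (uniq _ _ _ _ Lx Ld) eD in xD.
have := n_gt1; rewrite -cardsT (cardsD1 x) inE ltnS => /card_gt0P[z].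
rewrite !inE andbT => /negP[]; rewrite -cx; apply/eqP.
by apply: (uniq z x) => //; rewrite (label_out lab) D0 ?closed_nbhd0 inE.
Qed.

End Greedy.

(** * Multiplicative weights *)

Lemma expR_half_le (R : realType) (z : R) : 0 <= z <= 1 ->
  expR (z / 2) <= 1 + z.
Proof.
move=> /andP[z0 z1]; have half_pos : 0 < 1 - z / 2 by lra.
rewrite -[z / 2]opprK expRN; apply: le_trans (_ : (1 - z / 2)^-1 <= _).
  by rewrite lef_pV2 ?posrE ?expR_gt0 // expR_ge1Dx.
by rewrite -[leLHS]mul1r ler_pdivrMr //; nra.
Qed.

Lemma mul4_ln_le_sqr (R : realType) (x : R) : 0 < x -> 4 * ln x <= x ^+ 2.
Proof.
move=> x_gt0; have : ln x <= x - 1.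
  by have := @le_ln1Dx R (x - 1); rewrite [1 + _]addrC subrK; apply; lra.
by have := sqr_ge0 (x - 2); rewrite !expr2; lra.
Qed.

Section Packings.
Variables (T : finType) (G : sgraph T) (R : realType) (cap : T -> R).
Hypothesis cap_ge0 : forall v, 0 <= cap v.
Implicit Types (pk : seq ({set T} * R)) (e : {set T} * R) (D : {set T}).
Implicit Types (c beta : R) (v : T).

Definition total_weight pk : R := \sum_(e <- pk) e.2.

Definition load pk v : R := \sum_(e <- pk | v \in e.1) e.2.

Definition max_load pk : R := \big[Num.max/0]_v (load pk v / cap v).

Definition weight pk v : R :=
  (cap v)^-1 * \prod_(e <- pk | v \in e.1) (1 + e.2 / cap v).

Lemma total_weight_rcons pk D c :
  total_weight (rcons pk (D, c)) = total_weight pk + c.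
Proof. by rewrite /total_weight big_rcons. Qed.

Lemma load_rcons pk D c v :
  load (rcons pk (D, c)) v = if v \in D then load pk v + c else load pk v.
Proof. by rewrite /load big_rcons /=; case: ifP; rewrite ?addr0. Qed.

Lemma weight_rcons pk D c v : weight (rcons pk (D, c)) v =
  if v \in D then weight pk v + weight pk v * c / cap v else weight pk v.
Proof.
rewrite /weight big_rcons /=; case: ifP; rewrite ?mulr1 // => _.
by rewrite mulrA mulrDr mulr1 !mulrA.
Qed.

Lemma potential_weight_rcons pk D c : {in D, forall v, 0 < cap v} ->
  potential cap (weight (rcons pk (D, c))) =
    potential cap (weight pk) + c * \sum_(v in D) weight pk v.
Proof.
move=> pos; rewrite /potential mulr_sumr [X in _ + X]big_mkcond -big_split /=.
apply: eq_bigr => v _; rewrite weight_rcons; case: ifP => [/pos cv|_].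
  by field; rewrite gt_eqF.
by rewrite addr0.
Qed.

Lemma potential_weight_nil : potential cap (weight [::]) <= #|T|%:R.
Proof.
rewrite /potential -sum1_card natr_sum; apply: ler_sum => v _.
rewrite /weight big_nil mulr1.
by have [->|cv] := eqVneq (cap v) 0; rewrite ?mul0r ?divff.
Qed.

(* The failing runs of the greedy algorithm may add an empty set, with weight
   zero. *)
Definition admissible e : Prop :=
  [/\ 0 <= e.2, {in e.1, forall v, 0 < cap v /\ e.2 <= cap v} &
      e = (set0, 0) \/ exists2 v, v \in e.1 & cap v = e.2].

Section Admissible.
Variable pk : seq ({set T} * R).
Hypothesis adm : {in pk, forall e, admissible e}.

Lemma total_weight_ge0 : 0 <= total_weight pk.
Proof. by rewrite /total_weight big_seq sumr_ge0 // => e /adm[]. Qed.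

Lemma load_eq0 v : cap v = 0 -> load pk v = 0.
Proof.
move=> cv; rewrite /load big_seq_cond big1 // => e /andP[/adm[_ pos _] /pos[]].
by rewrite cv ltxx.
Qed.

Lemma weight_gt0 : positive_weight cap (weight pk).
Proof.
move=> v cv; apply: mulr_gt0; first by rewrite invr_gt0.
rewrite big_seq_cond; apply: prodr_gt0 => e /andP[/adm[e0 _ _] _].
by rewrite ltr_pwDl // divr_ge0.
Qed.

Lemma max_load_ge0 : 0 <= max_load pk.
Proof. exact: bigmax_ge_id. Qed.

Lemma load_le_max v : load pk v <= max_load pk * cap v.
Proof.
have [cv|cv] := cap_eq0_or_gt0 cap_ge0 v.
  by rewrite load_eq0 // cv mulr0.
by rewrite -ler_pdivrMr //; apply: (le_bigmax _ (fun v => load pk v / cap v)).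
Qed.

Lemma expR_load_le v : 0 < cap v ->
  expR (load pk v / cap v / 2) <= cap v * weight pk v.
Proof.
move=> cv; rewrite mulVKf ?gt_eqF // !mulr_suml expR_sum.
rewrite big_seq_cond [leRHS]big_seq_cond.
apply: ler_prod => e /andP[/adm[e0 le_e _] /le_e[_ ecv]].
rewrite expR_ge0 expR_half_le // divr_ge0 //=.
by rewrite ler_pdivrMr // mul1r.
Qed.

(* Every set is saturated at a vertex of minimal capacity. *)
Lemma size_le_load : {in pk, forall e, e.1 != set0} ->
  (size pk)%:R <= \sum_v load pk v / cap v.
Proof.
move=> nonempty; under eq_bigr do rewrite mulr_suml.
rewrite (exchange_big_dep predT) //= -sum1_size natr_sum.
rewrite big_seq [leRHS]big_seq; apply: ler_sum => e epk.
have [_ le_e [e_empty|[x xe cx]]] := adm epk.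
  by have := nonempty e epk; rewrite e_empty eqxx.
have [x_pos _] := le_e x xe.
rewrite (bigD1 x) //= -cx divff ?gt_eqF // lerDl.
by apply: sumr_ge0 => v /andP[_ _]; rewrite divr_ge0.
Qed.

Lemma size_le_max_load : {in pk, forall e, e.1 != set0} ->
  (size pk)%:R <= #|T|%:R * max_load pk.
Proof.
move=> nonempty; apply: le_trans (size_le_load nonempty) _.
rewrite mulr_natl -sumr_const; apply: ler_sum => v _.
exact: (le_bigmax _ (fun v => load pk v / cap v)).
Qed.

End Admissible.

Inductive cheap_history beta : seq ({set T} * R) -> Prop :=
| CheapNil : cheap_history beta [::]
| CheapRcons pk D c : cheap_history beta pk ->
    \sum_(v in D) weight pk v <= beta * potential cap (weight pk) ->
    cheap_history beta (rcons pk (D, c)).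

Lemma potential_cheap_history beta pk : {in pk, forall e, admissible e} ->
  cheap_history beta pk ->
  potential cap (weight pk) <= #|T|%:R * expR (beta * total_weight pk).
Proof.
move=> + cheap; elim: cheap => [_|{}pk D c _ IHpk costD adm].
  by rewrite /total_weight big_nil mulr0 expR0 mulr1 potential_weight_nil.
have adm_pk : {in pk, forall e, admissible e}.
  by move=> e epk; apply: adm; rewrite mem_rcons inE epk orbT.
have [c_ge0 leD _] : admissible (D, c).
  by apply: adm; rewrite mem_rcons mem_head.
rewrite potential_weight_rcons => [|v /leD[]//].
set Phi := potential cap (weight pk) in IHpk costD *.
have Phi_ge0 : 0 <= Phi by exact/potential_ge0/weight_gt0.
apply: le_trans (_ : Phi * (1 + beta * c) <= _).
  rewrite mulrDr mulr1 lerD2l (_ : Phi * _ = c * (beta * Phi)); last by ring.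
  exact: ler_wpM2l.
apply: le_trans (ler_wpM2l Phi_ge0 (expR_ge1Dx _)) _.
rewrite total_weight_rcons mulrDr expRD mulrA.
by apply: ler_wpM2r; [exact: expR_ge0 | exact: IHpk].
Qed.

Lemma max_load_le beta pk : {in pk, forall e, admissible e} ->
  (0 < #|T|)%N -> 0 <= beta -> cheap_history beta pk ->
  max_load pk / 2 <= ln #|T|%:R + beta * total_weight pk.
Proof.
move=> adm T_gt0 beta_ge0 cheap; rewrite ler_pdivrMr //.
have bound_ge0 : 0 <= ln #|T|%:R + beta * total_weight pk :> R.
  by rewrite addr_ge0 ?ln_ge0 ?ler1n // mulr_ge0 ?total_weight_ge0.
apply: bigmax_le => [|v _]; first by rewrite mulr_ge0.
have [->|cv] := cap_eq0_or_gt0 cap_ge0 v.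
  by rewrite invr0 mulr0 mulr_ge0.
rewrite -ler_pdivrMr // -ler_expR expRD lnK ?posrE ?ltr0n //.
apply: le_trans (expR_load_le adm cv) _.
apply: le_trans (potential_cheap_history adm cheap).
exact/le_potential/weight_gt0.
Qed.

(* A load of at least n ^ 2 makes the initial potential n negligible. *)
Lemma packing_size_ge beta pk : {in pk, forall e, admissible e} ->
  {in pk, forall e, e.1 != set0} -> size pk = (#|T| ^ 3)%N ->
  (0 < #|T|)%N -> 0 < beta -> cheap_history beta pk ->
  1 / (4 * beta) <= total_weight pk / max_load pk.
Proof.
move=> adm nonempty pk_size T_gt0 beta_gt0 cheap.
have n_gt0 : 0 < #|T|%:R :> R by rewrite ltr0n.
have := size_le_max_load adm nonempty.
rewrite pk_size natrX exprS ler_pM2l // => n2_le.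
have ln_le := le_trans (mul4_ln_le_sqr n_gt0) n2_le.
have max_gt0 : 0 < max_load pk by apply: lt_le_trans n2_le; apply: exprn_gt0.
have := max_load_le adm T_gt0 (ltW beta_gt0) cheap => half_le.
rewrite ler_pdivlMr // mulrAC mul1r ler_pdivrMr ?mulr_gt0 //.
rewrite [_ * (4 * _)]mulrCA [total_weight _ * _]mulrC.
by move: half_le ln_le; lra.
Qed.

End Packings.

(** * Memory layout *)

(* Integer and real arrays are numbered independently. The input and output
   formats fix the integer arrays 0 to 3 and the real arrays 0 and 1. *)
Definition adj_arr : nat := 1.
Definition count_reg : nat := 2.
Definition out_set_arr : nat := 3.
(* Cell x holds x * n, since programs cannot multiply integers. *)
Definition row_arr : nat := 4.
Definition set_arr : nat := 5.
Definition label_arr : nat := 6.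
Definition mark_arr : nat := 7.
Definition spider_arr : nat := 8.
Definition best_center_reg : nat := 9.
Definition found_reg : nat := 10.
Definition failed_reg : nat := 11.
Definition out_offset_reg : nat := 12.
Definition out_index_reg : nat := 13.
Definition center_reg : nat := 14.
Definition bound_reg : nat := 15.
Definition leg_reg : nat := 16.
Definition outer_ctr : nat := 17.
Definition inner_ctr : nat := 18.
Definition step_ctr : nat := 19.
Definition round_ctrs : seq nat := [:: 20; 21; 22]%N.

Definition cap_arr : nat := 0.
Definition out_weight_arr : nat := 1.
Definition weight_arr : nat := 2.
Definition load_arr : nat := 3.
Definition threshold_reg : nat := 4.
Definition mark_count_reg : nat := 5.
Definition old_count_reg : nat := 6.
Definition center_count_reg : nat := 7.
Definition best_threshold_reg : nat := 8.
Definition best_ratio_reg : nat := 9.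
Definition min_cap_reg : nat := 10.
Definition max_load_reg : nat := 11.

Definition ieq (e1 e2 : iexp) : bexp := BAnd (BIle e1 e2) (BIle e2 e1).
Definition ior (b1 b2 : bexp) : bexp := BNot (BAnd (BNot b1) (BNot b2)).
Definition ipos (e : iexp) : bexp := BIle (IConst 1) e.
Definition izero (e : iexp) : bexp := BIle e (IConst 0).
Definition rpos (e : rexp) : bexp := BNot (BRle e (RConst 0)).
Definition icell (a x : nat) : iexp := ILoad a (ireg x).
Definition rcell (a x : nat) : rexp := RLoad a (ireg x).
Definition adjacent (x y : nat) : bexp :=
  ipos (ILoad adj_arr (IAdd (icell row_arr x) (ireg y))).

Section Contents.
Variables (n : nat) (A : Type).
Implicit Types (m : nat -> nat -> A) (f g : 'I_n -> A) (X : {set 'I_n}).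

Definition array m a f : Prop := forall i : 'I_n, m a i = f i.

Definition patch X f g (x : 'I_n) : A := if x \in X then f x else g x.

Lemma array_patch0 m a f g : array m a g -> array m a (patch set0 f g).
Proof. by move=> mg x; rewrite /patch inE mg. Qed.

Lemma array_patchT m a f g : array m a (patch setT f g) -> array m a f.
Proof. by move=> mf x; rewrite mf /patch inE. Qed.

Lemma array_patchU1 m m' a X f g (i : 'I_n) :
  (forall j : 'I_n, j != i -> m' a j = m a j) -> m' a i = f i ->
  array m a (patch X f g) -> array m' a (patch (i |: X) f g).
Proof.
move=> m'E m'i mX x; rewrite /patch in_setU1.
by case: eqVneq => [->//|xi]; rewrite m'E.
Qed.

End Contents.

Section States.
Variables (R : realType) (n : nat).
Implicit Types (s : state R) (X : {set 'I_n}) (L : 'I_n -> option 'I_n).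

Definition ints a (f : 'I_n -> nat) s : Prop := array (imem s) a f.
Definition reals a (f : 'I_n -> R) s : Prop := array (rmem s) a f.
Definition set_at a X s : Prop := ints a (fun x => nat_of_bool (x \in X)) s.

(* 0 encodes the absence of a label. *)
Definition label_code L (x : 'I_n) : nat :=
  oapp (fun c : 'I_n => c.+1) 0%N (L x).

Lemma label_code_gt0 L x : (0 < label_code L x)%N = (L x != None).
Proof. by rewrite /label_code; case: (L x). Qed.

Lemma label_code_eq L x y : (label_code L x == label_code L y) = (L x == L y).
Proof. by rewrite /label_code; case: (L x) => [c|]; case: (L y). Qed.

Lemma ints_agree p s s' a f :
  agree p s s' -> a \notin int_writes p -> ints a f s -> ints a f s'.
Proof. by move=> ag ap sf x; rewrite (agree_int ag). Qed.

Lemma reals_agree p s s' a f :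
  agree p s s' -> a \notin real_writes p -> reals a f s -> reals a f s'.
Proof. by move=> ag ap sf x; rewrite (agree_real ag). Qed.

Lemma ints_run p s a f :
  a \notin int_writes p -> ints a f s -> ints a f (run p s).
Proof. exact/ints_agree/run_agree. Qed.

Lemma reals_run p s a f :
  a \notin real_writes p -> reals a f s -> reals a f (run p s).
Proof. exact/reals_agree/run_agree. Qed.

Lemma run_skip s : run PSkip s = s. Proof. by []. Qed.
Lemma run_seq p q s : run (p ;; q) s = run q (run p s). Proof. by []. Qed.
Lemma run_if b p q s :
  run (PIf b p q) s = if beval s b then run p s else run q s.
Proof. by []. Qed.
Lemma run_istore a i e s :
  run (PIStore a i e) s = iset a (ieval s i) (ieval s e) s.
Proof. by []. Qed.
Lemma run_rstore a i e s :
  run (PRStore a i e) s = rset a (ieval s i) (reval s e) s.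
Proof. by []. Qed.
Definition runE := (run_skip, run_seq, run_if, run_istore, run_rstore).

Lemma beval_ieq s e1 e2 : beval s (ieq e1 e2) = (ieval s e1 == ieval s e2).
Proof. by rewrite eqn_leq. Qed.
Lemma beval_ior s b1 b2 : beval s (ior b1 b2) = beval s b1 || beval s b2.
Proof. by rewrite /= negb_and !negbK. Qed.
Lemma beval_ipos s e : beval s (ipos e) = (0 < ieval s e)%N.
Proof. by []. Qed.
Lemma beval_izero s e : beval s (izero e) = (ieval s e == 0%N).
Proof. by rewrite /= leqn0. Qed.
Lemma beval_rpos s e : beval s (rpos e) = (0 < reval s e).
Proof. by rewrite /= -ltNge. Qed.
Lemma beval_and s b1 b2 : beval s (BAnd b1 b2) = beval s b1 && beval s b2.
Proof. by []. Qed.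
Lemma beval_not s b : beval s (BNot b) = ~~ beval s b.
Proof. by []. Qed.
Lemma beval_rle s e1 e2 : beval s (BRle e1 e2) = (reval s e1 <= reval s e2).
Proof. by []. Qed.
Definition bevalE := (beval_ieq, beval_ior, beval_ipos, beval_izero, beval_rpos,
  beval_and, beval_not, beval_rle).

End States.

(** * Building one spider *)

Definition mark_index (x : nat) : iexp := ISub (icell label_arr x) (IConst 1).

Definition mark_label (x : nat) : prog :=
  PWhen (BAnd (ipos (icell label_arr x))
              (izero (ILoad mark_arr (mark_index x))))
    (PIStore mark_arr (mark_index x) (IConst 1);;
     PRSet mark_count_reg (RAdd (rreg mark_count_reg) (RConst 1))).

Definition in_closed_nbhd (x y : nat) : bexp :=
  ior (ieq (ireg y) (ireg x)) (adjacent x y).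

Definition touch_vertex (x : nat) : prog :=
  PFor inner_ctr (PWhen (in_closed_nbhd x inner_ctr) (mark_label inner_ctr)).

Definition clear_marks : prog :=
  PFor inner_ctr (PIStore mark_arr (ireg inner_ctr) (IConst 0);;
                  PIStore spider_arr (ireg inner_ctr) (IConst 0)).

Definition is_leg : bexp :=
  BAnd (adjacent center_reg leg_reg)
    (BAnd (izero (icell set_arr leg_reg))
       (BAnd (rpos (rcell cap_arr leg_reg))
          (BRle (rcell weight_arr leg_reg) (rreg threshold_reg)))).

Definition touch_leg : prog :=
  touch_vertex leg_reg;;
  PIf (BRle (rreg mark_count_reg) (rreg old_count_reg)) PSkip
    (PIStore spider_arr (ireg leg_reg) (IConst 1)).

Definition add_legs : prog :=
  PFor leg_reg (PWhen is_leg
    (PRSet old_count_reg (rreg mark_count_reg);; touch_leg)).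

Definition build_spider : prog :=
  clear_marks;;
  PIStore spider_arr (ireg center_reg) (IConst 1);;
  PRSet mark_count_reg (RConst 0);;
  touch_vertex center_reg;;
  PRSet center_count_reg (rreg mark_count_reg);;
  add_legs.

Lemma setIU1 (T : finType) (x : T) (A B : {set T}) :
  (x |: A) :&: B = if x \in B then x |: (A :&: B) else A :&: B.
Proof.
case: ifP => xB; rewrite setIUl; first by rewrite (setIidPl _) // sub1set.
by rewrite disjoint_setI0 ?set0U ?disjoints1 ?xB.
Qed.

Section SpiderPrograms.
Variables (R : realType) (n : nat) (G : sgraph 'I_n) (cap : 'I_n -> R).
Implicit Types (s : state R) (D X M A : {set 'I_n}) (L : 'I_n -> option 'I_n).
Implicit Types (w : 'I_n -> R) (u v : 'I_n) (t : R).

Definition graph_loaded s : Prop :=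
  [/\ imem s size_reg 0 = n,
      forall i j : 'I_n, imem s adj_arr (i * n + j)%N = G i j,
      ints row_arr (fun i : 'I_n => i * n)%N s & reals cap_arr cap s].

Definition keeps_graph p : bool :=
  ~~ has (mem (int_writes p)) [:: size_reg; adj_arr; row_arr] &&
  (cap_arr \notin real_writes p).

Lemma graph_loaded_agree p s s' : agree p s s' -> keeps_graph p ->
  graph_loaded s -> graph_loaded s'.
Proof.
move=> ag; rewrite /keeps_graph /= orbF !negb_or.
move=> /andP[/and3P[kept_n kept_adj kept_row] kept_cap] [s_n s_adj s_row s_cap].
split=> [|i j||].
- by rewrite (agree_int ag).
- by rewrite (agree_int ag).
- exact: (ints_agree ag).
- exact: (reals_agree ag).
Qed.

Lemma graph_loaded_run p s :
  keeps_graph p -> graph_loaded s -> graph_loaded (run p s).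
Proof. exact/graph_loaded_agree/run_agree. Qed.

Lemma beval_adjacent s a b u v : graph_loaded s ->
  imem s a 0 = u -> imem s b 0 = v -> beval s (adjacent a b) = G u v.
Proof.
by case=> _ s_adj s_row _ sa sb; rewrite /= sa sb s_row s_adj; case: (G u v).
Qed.

Definition marked M s : Prop :=
  set_at mark_arr M s /\ rmem s mark_count_reg 0 = #|M|%:R.

Lemma mark_label_spec a s L M (y : 'I_n) : imem s a 0 = y ->
  ints label_arr (label_code L) s -> marked M s ->
  marked (M :|: labels L [set y]) (run (mark_label a) s).
Proof.
move=> sa sL [sM sC]; rewrite !runE !bevalE /= sa sL /label_code labels1.
case Ly: (L y) => [c|] /=; last by rewrite setU0.
rewrite subn1 /= sM eqb0; case: (boolP (c \in M)) => cM /=.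
  by rewrite (setUidPl _) // sub1set.
split=> [d|] /=.
  rewrite updE sM !inE -val_eqE /=.
  by case: eqVneq; rewrite ?orbT ?orbF.
by rewrite !updE sC setUC cardsU1 cM natrD addrC.
Qed.

Lemma touch_vertex_spec a s u L M :
  a \notin int_writes (touch_vertex a) -> graph_loaded s ->
  imem s a 0 = u -> ints label_arr (label_code L) s -> marked M s ->
  marked (M :|: touched G L [set u]) (run (touch_vertex a) s).
Proof.
move=> a_fresh graph sa sL sM; set N := closed_nbhd G [set u].
pose J A := marked (M :|: labels L (A :&: N)).
suff : J setT (run (touch_vertex a) s) by rewrite /J setTI.
apply: for_ind => //; first by case: graph.
  by rewrite /J set0I labels0 setU0.
move=> i A s' _ ag s'i s'M.
have graph' : graph_loaded s' by apply: graph_loaded_agree ag _ graph.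
have s'a : imem s' a 0 = u by rewrite (agree_int ag).
have s'L : ints label_arr (label_code L) s' by apply: ints_agree ag _ sL.
rewrite run_if beval_ior beval_ieq (beval_adjacent graph' s'a s'i) /= s'i s'a.
rewrite val_eqE -in_closed_nbhd1 -/N run_skip.
rewrite /J setIU1; case: ifP => // iN; rewrite labelsU setUCA setUC.
exact: mark_label_spec s'i s'L s'M.
Qed.

Lemma clear_marks_spec s : graph_loaded s ->
  set_at mark_arr (set0 : {set 'I_n}) (run clear_marks s) /\
  set_at spider_arr (set0 : {set 'I_n}) (run clear_marks s).
Proof.
case=> s_n _ _ _; pose J A s' := forall x : 'I_n, x \in A ->
  imem s' mark_arr x = 0%N /\ imem s' spider_arr x = 0%N.
suff cleared : J setT (run clear_marks s).
  by split=> x; rewrite inE; have [] := cleared x (in_setT x).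
apply: for_ind => //; first by move=> x; rewrite inE.
move=> i A s' _ _ s'i IHA x; rewrite !runE /= !updE /= s'i in_setU1 val_eqE.
by case: eqVneq => //= _; apply: IHA.
Qed.

Definition spider_built D L w v t s : Prop :=
  [/\ marked (reach G cap w D L t v) s,
      rmem s center_count_reg 0 = #|touched G L [set v]|%:R &
      exists2 X, set_at spider_arr X s & spider G cap w D L t v X].

Definition greedy_loaded w D L s : Prop :=
  [/\ graph_loaded s, set_at set_arr D s, ints label_arr (label_code L) s &
      reals weight_arr w s].

Definition keeps_greedy p : bool :=
  ~~ has (mem (int_writes p))
    [:: size_reg; adj_arr; row_arr; set_arr; label_arr] &&
  ~~ has (mem (real_writes p)) [:: cap_arr; weight_arr].

Lemma greedy_loaded_agree p s s' w D L : agree p s s' -> keeps_greedy p ->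
  greedy_loaded w D L s -> greedy_loaded w D L s'.
Proof.
move=> ag; rewrite /keeps_greedy /= !orbF !negb_or.
case/andP=> /and5P[kept_n kept_adj kept_row kept_set kept_label].
case/andP=> kept_cap kept_weight [graph sD sL sw]; split.
- apply: graph_loaded_agree ag _ graph.
  by rewrite /keeps_graph /= orbF !negb_or kept_n kept_adj kept_row.
- exact: (ints_agree ag).
- exact: (ints_agree ag).
- exact: (reals_agree ag).
Qed.

Lemma greedy_loaded_run p s w D L : keeps_greedy p ->
  greedy_loaded w D L s -> greedy_loaded w D L (run p s).
Proof. exact/greedy_loaded_agree/run_agree. Qed.

Lemma beval_is_leg s w D L v t u : greedy_loaded w D L s ->
  imem s center_reg 0 = v -> rmem s threshold_reg 0 = t ->
  imem s leg_reg 0 = u -> beval s is_leg = (u \in legs G cap w D t v).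
Proof.
move=> [graph sD _ sw] sv st su; have [_ _ _ sc] := graph.
rewrite beval_and (beval_adjacent graph sv su) !bevalE /= su sD sw sc st eqb0.
by rewrite !inE andbC.
Qed.

Lemma touch_leg_spec s w D L v t X A u :
  positive_weight cap w ->
  greedy_loaded w D L s -> imem s leg_reg 0 = u -> u \in legs G cap w D t v ->
  u \notin A -> marked (touched G L (v |: A)) s ->
  rmem s old_count_reg 0 = #|touched G L (v |: A)|%:R ->
  set_at spider_arr X s -> partial_spider G w L t v A X ->
  marked (touched G L (v |: (u |: A))) (run touch_leg s) /\
  exists2 Y, set_at spider_arr Y (run touch_leg s) &
    partial_spider G w L t v (u |: A) Y.
Proof.
move=> w_gt0 [graph _ sL _] su u_leg uA sM s_old sX part.
rewrite /touch_leg run_seq.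
have touchE : touched G L (v |: (u |: A)) =
    touched G L (v |: A) :|: touched G L [set u].
  by rewrite setUCA touchedU setUC.
have := touch_vertex_spec (a := leg_reg) isT graph su sL sM.
rewrite -touchE; set s1 := run (touch_vertex _) s => s1M.
have s1X : set_at spider_arr X s1 by apply: ints_run.
have s1u : imem s1 leg_reg 0 = u by rewrite imem_run.
have [_ s1C] := s1M; rewrite run_if beval_rle /= s1C rmem_run // s_old ler_nat.
rewrite touchE; case: leqP => [le_card|lt_card].
  rewrite run_skip -touchE; split=> //; exists X => //.
  apply: partial_spider_skip part.
  have /eqP -> : touched G L (v |: A) ==
      touched G L (v |: A) :|: touched G L [set u].
    by rewrite eqEcard subsetUl.
  exact: subsetUr.
rewrite run_istore /= s1u -touchE; split=> //; exists (u |: X).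
  by move=> y; rewrite /= updE /= s1X !inE val_eqE; case: eqVneq.
apply: partial_spider_add u_leg uA _ part => //.
by apply: contraL lt_card => /setUidPl ->; rewrite ltnn.
Qed.

Lemma add_legs_spec s w D L v t : positive_weight cap w ->
  greedy_loaded w D L s -> imem s center_reg 0 = v ->
  rmem s threshold_reg 0 = t -> v \notin D -> 0 < cap v ->
  marked (touched G L [set v]) s -> set_at spider_arr [set v] s ->
  rmem s center_count_reg 0 = #|touched G L [set v]|%:R ->
  spider_built D L w v t (run add_legs s).
Proof.
move=> w_gt0 loaded sv st vD cv sM sX s_center; set F := legs G cap w D t v.
pose J A s' := marked (touched G L (v |: (A :&: F))) s' /\
  exists2 X, set_at spider_arr X s' & partial_spider G w L t v (A :&: F) X.
suff : J setT (run add_legs s).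
  rewrite /J setTI => -[legs_marked [X legs_set part]]; split=> //.
    by rewrite rmem_run.
  by exists X => //; apply: partial_spider_full part.
apply: for_ind => //; first by case: loaded => -[].
  rewrite /J set0I setU0; split=> //.
  by exists [set v] => //; apply: partial_spider0.
move=> i A s' iA ag s'i [s'M [X s'X part]].
have loaded' : greedy_loaded w D L s' by apply: greedy_loaded_agree ag _ loaded.
have s'v : imem s' center_reg 0 = v by rewrite (agree_int ag).
have s't : rmem s' threshold_reg 0 = t by rewrite (agree_real ag).
rewrite run_if (beval_is_leg loaded' s'v s't s'i) -/F /J setIU1.
case: ifP => iF; last by split; last exists X.
rewrite run_seq run_rstore.
apply: (touch_leg_spec (X := X)) iF _ _ _ _ part => //.
  by rewrite inE (negPf iA).
by rewrite /= updE /=; case: s'M.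
Qed.

Lemma build_spider_spec s w D L v t : positive_weight cap w ->
  greedy_loaded w D L s -> imem s center_reg 0 = v ->
  rmem s threshold_reg 0 = t -> v \notin D -> 0 < cap v ->
  spider_built D L w v t (run build_spider s).
Proof.
move=> w_gt0 loaded sv st vD cv; have [graph _ _ _] := loaded.
have [cleared_marks cleared_spider] := clear_marks_spec graph.
rewrite /build_spider run_seq; set s1 := run clear_marks s.
have loaded1 : greedy_loaded w D L s1 by apply: greedy_loaded_run.
have s1v : imem s1 center_reg 0 = v by rewrite imem_run.
rewrite 2!run_seq run_istore run_rstore /= s1v.
set s2 := rset _ _ _ _; have [graph2 _ L2 _] : greedy_loaded w D L s2 by [].
have s2M : marked set0 s2 by split; [exact: cleared_marks | rewrite cards0].
have s2v : imem s2 center_reg 0 = v by [].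
have := touch_vertex_spec (a := center_reg) isT graph2 s2v L2 s2M.
rewrite set0U !run_seq run_rstore; set s3 := run (touch_vertex _) s2 => s3M.
apply: add_legs_spec => //.
- exact: (@greedy_loaded_run (touch_vertex center_reg)).
- by rewrite [LHS]imem_run.
- by rewrite [LHS]/= upd_neq // rmem_run //= upd_neq // rmem_run.
- move=> x; rewrite [LHS]imem_run //= updE cleared_spider !inE val_eqE.
  by case: eqVneq.
by rewrite /= updE /=; case: s3M.
Qed.

End SpiderPrograms.

(** * Choosing the cheapest spider *)

Definition ratio_expr : rexp :=
  RDiv (RAdd (rcell weight_arr center_reg)
          (RMul (rreg threshold_reg)
             (RSub (rreg mark_count_reg) (rreg center_count_reg))))
       (RSub (rreg mark_count_reg) (RConst 1)).

Definition keep_best : prog :=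
  PWhen (BAnd (BRle (RConst 2) (rreg mark_count_reg))
           (ior (izero (ireg found_reg))
              (BRle ratio_expr (rreg best_ratio_reg))))
    (PISet found_reg (IConst 1);;
     PISet best_center_reg (ireg center_reg);;
     PRSet best_threshold_reg (rreg threshold_reg);;
     PRSet best_ratio_reg ratio_expr).

Definition set_threshold : prog :=
  PIf (ieq (ireg bound_reg) (ireg center_reg))
    (PRSet threshold_reg (RConst 0))
    (PRSet threshold_reg (rcell weight_arr bound_reg)).

Definition try_spider : prog := set_threshold;; build_spider;; keep_best.

Definition try_center : prog :=
  PWhen (BAnd (izero (icell set_arr center_reg))
              (rpos (rcell cap_arr center_reg)))
    (PFor bound_reg try_spider).

Definition select_spider : prog :=
  PISet found_reg (IConst 0);; PFor center_reg try_center.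

Definition set_label_to_center : prog :=
  PIStore label_arr (ireg outer_ctr) (IAdd (ireg center_reg) (IConst 1)).

Definition merge_vertex : prog :=
  PIf (ipos (icell spider_arr outer_ctr))
    (set_label_to_center;; PIStore set_arr (ireg outer_ctr) (IConst 1))
    (PWhen (BAnd (ipos (icell label_arr outer_ctr))
                 (ipos (ILoad mark_arr (mark_index outer_ctr))))
       (PIf (ipos (icell set_arr outer_ctr)) set_label_to_center
          (PIStore label_arr (ireg outer_ctr) (IConst 0)))).

Definition merge_spider : prog := PFor outer_ctr merge_vertex.

Definition greedy_round : prog :=
  select_spider;;
  PWhen (ipos (ireg found_reg))
    (PISet center_reg (ireg best_center_reg);;
     PRSet threshold_reg (rreg best_threshold_reg);;
     build_spider;; merge_spider).

Section GreedyRound.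
Variables (R : realType) (n : nat) (G : sgraph 'I_n) (cap w : 'I_n -> R).
Hypothesis w_gt0 : positive_weight cap w.
Implicit Types (s : state R) (D X : {set 'I_n}) (L : 'I_n -> option 'I_n).
Implicit Types (u v x : 'I_n) (t : R) (P : 'I_n -> 'I_n -> bool).
Local Notation greedy_loaded := (greedy_loaded G cap w).
Local Notation candidate := (candidate G cap w).
Local Notation threshold := (threshold w).
Local Notation spider_ratio := (spider_ratio G cap w).

Definition best_among D L P s : Prop :=
  (imem s found_reg 0 = 0%N /\
     forall v u, P v u -> ~~ candidate D L (threshold v u) v) \/
  (imem s found_reg 0 = 1%N /\ exists v t,
     [/\ imem s best_center_reg 0 = v, rmem s best_threshold_reg 0 = t,
         rmem s best_ratio_reg 0 = spider_ratio D L t v, candidate D L t v &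
         forall v' u, P v' u -> candidate D L (threshold v' u) v' ->
           spider_ratio D L t v <= spider_ratio D L (threshold v' u) v']).

Lemma eq_best_among D L P P' s : P =2 P' ->
  best_among D L P s -> best_among D L P' s.
Proof.
move=> PP' [[s_found none]|[s_found [v [t [sv st sr cand best]]]]].
  by left; split=> // v u; rewrite -PP'; apply: none.
by right; split=> //; exists v, t; split=> // v' u; rewrite -PP'; apply: best.
Qed.

Definition add_pair P v u v' u' : bool := P v' u' || (v' == v) && (u' == u).

Lemma best_among_better D L P s v u : let t := threshold v u in
  imem s found_reg 0 = 1%N -> imem s best_center_reg 0 = v ->
  rmem s best_threshold_reg 0 = t ->
  rmem s best_ratio_reg 0 = spider_ratio D L t v -> candidate D L t v ->
  (forall v' u', P v' u' -> candidate D L (threshold v' u') v' ->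
     spider_ratio D L t v <= spider_ratio D L (threshold v' u') v') ->
  best_among D L (add_pair P v u) s.
Proof.
move=> t s_found sv st sr cand best; right; split=> //.
by exists v, t; split=> // v' u' /orP[/best//|/andP[/eqP-> /eqP->]].
Qed.

Lemma keep_best_spec D L P s v u : greedy_loaded D L s ->
  imem s center_reg 0 = v -> rmem s threshold_reg 0 = threshold v u ->
  spider_built G cap D L w v (threshold v u) s ->
  v \notin D -> 0 < cap v -> best_among D L P s ->
  best_among D L (add_pair P v u) (run keep_best s).
Proof.
move=> [_ _ _ sw] sv st [[_ sC] s_center _] vD cv best.
have ratioE : reval s ratio_expr = spider_ratio D L (threshold v u) v.
  by rewrite /= sv sC s_center st sw.
have candE : candidate D L (threshold v u) v =
    (1 < #|reach G cap w D L (threshold v u) v|)%N.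
  by rewrite /candidate vD cv.
rewrite run_if beval_and beval_ior !beval_rle beval_izero ratioE.
rewrite [reval s (RConst 2)]/= [reval s (rreg mark_count_reg)]/= sC.
rewrite (ler_nat R 2) -candE [ieval s _]/= [reval s _]/=.
case: ifP => [/andP[cand better]|not_better]; last first.
  case: best => [[s_found none]|[s_found [v0 [t0 [sv0 st0 sr cand0 best]]]]].
    left; split=> // v' u' /orP[/none//|/andP[/eqP-> /eqP->]].
    by move: not_better; rewrite s_found eqxx andbT => ->.
  right; split=> //; exists v0, t0; split=> // v' u'.
  case/orP=> [/best//|/andP[/eqP-> /eqP->] cand].
  move: not_better; rewrite cand s_found sr /= => /negbT.
  by rewrite -ltNge => /ltW.
rewrite !run_seq !run_istore !run_rstore.
rewrite [reval (rset _ _ _ _) ratio_expr](_ : _ = reval s ratio_expr) // ratioE.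
apply: best_among_better => // v' u' Pvu' cand'.
case: best => [[_ none]|[s_found [v0 [t0 [_ _ sr _ best]]]]].
  by rewrite (negPf (none _ _ Pvu')) in cand'.
move: better; rewrite s_found sr /= => /le_trans; apply; exact: best.
Qed.

Lemma try_spider_spec D L P s v u : greedy_loaded D L s ->
  imem s center_reg 0 = v -> imem s bound_reg 0 = u ->
  v \notin D -> 0 < cap v -> best_among D L P s ->
  best_among D L (add_pair P v u) (run try_spider s).
Proof.
move=> loaded sv su vD cv best; have [_ _ _ sw] := loaded.
have -> : run try_spider s =
    run keep_best (run build_spider (rset threshold_reg 0 (threshold v u) s)).
  rewrite /try_spider !run_seq; congr (run _ (run _ _)).
  rewrite run_if beval_ieq !run_rstore /= sv su val_eqE sw /threshold.
  by case: ifP.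
set s1 := rset _ _ _ _; have loaded1 : greedy_loaded D L s1 by [].
have built : spider_built G cap D L w v (threshold v u) (run build_spider s1).
  exact: build_spider_spec.
apply: keep_best_spec => //.
- exact: greedy_loaded_run.
- by rewrite imem_run.
- by rewrite rmem_run.
case: best => [[s_found none]|[s_found [v0 [t0 [sv0 st0 sr cand best]]]]].
  by left; rewrite imem_run.
right; rewrite imem_run //; split=> //; exists v0, t0.
by rewrite imem_run // !rmem_run.
Qed.

Lemma try_center_spec D L P s v : greedy_loaded D L s ->
  imem s center_reg 0 = v -> best_among D L P s ->
  best_among D L (fun v' u => P v' u || (v' == v)) (run try_center s).
Proof.
move=> loaded sv best; have [[s_n _ _ s_cap] sD _ _] := loaded.
rewrite run_if beval_and beval_izero beval_rpos /= sv sD s_cap eqb0.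
case: ifP => [/andP[vD cv]|no_spider]; last first.
  have none u : ~~ candidate D L (threshold v u) v.
    by apply: contraFN no_spider => /and3P[-> ->].
  case: best => [[s_found old]|[s_found [v0 [t0 [sv0 st0 sr cand best]]]]].
    by left; split=> // v' u /orP[/old|/eqP->].
  right; split=> //; exists v0, t0; split=> // v' u /orP[/best//|/eqP->].
  by rewrite (negPf (none u)).
pose J (A : {set 'I_n}) :=
  best_among D L (fun v' u => P v' u || (v' == v) && (u \in A)).
suff : J setT (run (PFor bound_reg try_spider) s).
  by apply: eq_best_among => v' u; rewrite in_setT andbT.
apply: for_ind => //.
  by apply: eq_best_among best => v' u; rewrite inE andbF orbF.
move=> u A s' uA ag s'u bestA.
have loaded' : greedy_loaded D L s' by apply: greedy_loaded_agree ag _ _.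
have s'v : imem s' center_reg 0 = v by rewrite (agree_int ag).
apply: eq_best_among (try_spider_spec loaded' s'v s'u vD cv bestA) => v' u'.
by rewrite /add_pair in_setU1 -orbA -andb_orr [(u' \in A) || _]orbC.
Qed.

Lemma select_spider_spec D L s : greedy_loaded D L s ->
  best_among D L (fun _ _ => true) (run select_spider s).
Proof.
move=> loaded; rewrite /select_spider run_seq run_istore.
set s0 := iset _ _ _ _.
pose J (A : {set 'I_n}) := best_among D L (fun v _ => v \in A).
suff : J setT (run (PFor center_reg try_center) s0).
  by apply: eq_best_among => v u; rewrite inE.
apply: for_ind => //; first by case: loaded => -[].
  by left; split=> // v u; rewrite inE.
move=> v A s' _ ag s'v best.
have loaded' : greedy_loaded D L s' by apply: greedy_loaded_agree ag _ _.
apply: eq_best_among (try_center_spec loaded' s'v best) => v' u.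
by rewrite in_setU1 orbC.
Qed.

Lemma merge_vertex_spec D L X v s x : set_at mark_arr (touched G L X) s ->
  set_at spider_arr X s -> imem s center_reg 0 = v -> imem s outer_ctr 0 = x ->
  imem s set_arr x = (x \in D) -> imem s label_arr x = label_code L x ->
  [/\ imem (run merge_vertex s) set_arr x = (x \in D :|: X),
      imem (run merge_vertex s) label_arr x =
        label_code (merge_label G D L X v) x &
      forall a (j : 'I_n), j != x ->
        imem (run merge_vertex s) a j = imem s a j].
Proof.
move=> sM sX sv sx sD sL.
rewrite run_if beval_ipos /= sx sX lt0b in_setU orbC /label_code /merge_label.
case: (boolP (x \in X)) => xX.
  rewrite !runE /= [upd _ _ _ _ outer_ctr _]upd_neq // sx; split=> [||a j jx].
  - by rewrite updE /= eqxx.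
  - by rewrite !updE /= eqxx sv addn1.
  by rewrite !updE val_eqE (negPf jx) !andbF.
rewrite run_if beval_and !beval_ipos /= sx sL /label_code.
case Lx: (L x) => [c|] /=; last by rewrite run_skip sD sL /label_code Lx.
rewrite subn1 sM lt0b; case: ifP => cM; last first.
  by rewrite run_skip sD sL /label_code Lx.
rewrite run_if beval_ipos /= sx sD lt0b; case: ifP => xD.
  rewrite !runE /= sx sv addn1; split=> [||a j jx].
  - by rewrite updE /= sD xD.
  - by rewrite updE /= eqxx.
  by rewrite updE val_eqE (negPf jx) andbF.
rewrite !runE /= sx; split=> [||a j jx].
- by rewrite updE /= sD xD.
- by rewrite updE /= eqxx.
by rewrite updE val_eqE (negPf jx) andbF.
Qed.

Lemma merge_spider_spec s D L X v : greedy_loaded D L s ->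
  set_at mark_arr (touched G L X) s -> set_at spider_arr X s ->
  imem s center_reg 0 = v ->
  greedy_loaded (D :|: X) (merge_label G D L X v) (run merge_spider s).
Proof.
move=> [graph sD sL sw] sM sX sv; set L' := merge_label G D L X v.
pose J A s' := ints set_arr (patch A (fun x => nat_of_bool (x \in D :|: X))
                               (fun x => nat_of_bool (x \in D))) s' /\
  ints label_arr (patch A (label_code L') (label_code L)) s'.
suff [/array_patchT s'D /array_patchT s'L] : J setT (run merge_spider s).
  by split=> //; [exact: graph_loaded_run | exact: reals_run].
apply: for_ind => //; first by case: graph.
  by split; apply: array_patch0.
move=> x A s' xA ag s'x [s'D s'L].
have [] := @merge_vertex_spec D L X v s' x.
- exact: ints_agree ag _ sM.
- exact: ints_agree ag _ sX.
- by rewrite (agree_int ag).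
- by [].
- by rewrite s'D /patch (negPf xA).
- by rewrite s'L /patch (negPf xA).
move=> newD newL other; split.
  exact: array_patchU1 (other _) newD s'D.
exact: array_patchU1 (other _) newL s'L.
Qed.

Lemma greedy_round_spec s D L : greedy_loaded D L s ->
  exists D' L', greedy_loaded D' L' (run greedy_round s) /\
    greedy_step G cap w D L D' L'.
Proof.
move=> loaded; have best := select_spider_spec loaded.
rewrite /greedy_round run_seq; set s1 := run select_spider s in best *.
have loaded1 : greedy_loaded D L s1 by apply: greedy_loaded_run.
rewrite run_if beval_ipos /=.
case: best => [[-> none]|[-> [v [t [sv st _ cand best]]]]] /=.
  rewrite run_skip; exists D, L; split=> //.
  by apply: GreedyStuck => v u; apply: none.
rewrite 3!run_seq run_istore run_rstore /= sv st.
set s2 := rset _ _ _ _; have loaded2 : greedy_loaded D L s2 by [].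
have /and3P[vD cv _] := cand.
have [[s3M _] _ [X s3X X_spider]] :
    spider_built G cap D L w v t (run build_spider s2).
  exact: build_spider_spec.
have [_ _ _ touchX _] := X_spider.
exists (D :|: X), (merge_label G D L X v); split; last first.
  by apply: GreedyMerge cand X_spider _ => v' u; apply: best.
apply: merge_spider_spec => //; first exact: greedy_loaded_run.
  by rewrite touchX.
by rewrite imem_run.
Qed.

End GreedyRound.

(** * One round of packing *)

Definition init_greedy : prog :=
  PFor outer_ctr
    (PIStore set_arr (ireg outer_ctr) (IConst 0);;
     PIStore label_arr (ireg outer_ctr) (IAdd (ireg outer_ctr) (IConst 1))).

Definition greedy : prog := init_greedy;; PFor step_ctr greedy_round.

Section GreedyProgram.
Variables (R : realType) (n : nat) (G : sgraph 'I_n).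
Variables (cap w : 'I_n -> R) (k : R).
Hypothesis conG : graph_connected G.
Hypothesis cap_ge0 : forall v, 0 <= cap v.
Hypothesis w_gt0 : positive_weight cap w.
Implicit Types s : state R.

Lemma init_greedy_spec s : graph_loaded G cap s -> reals weight_arr w s ->
  greedy_loaded G cap w set0 (@Some 'I_n) (run init_greedy s).
Proof.
move=> graph sw; pose J (A : {set 'I_n}) s' := forall x, x \in A ->
  imem s' set_arr x = 0%N /\ imem s' label_arr x = x.+1.
suff inits : J setT (run init_greedy s).
  split; [exact: graph_loaded_run| | |exact: reals_run] => x;
    by have [] := inits x (in_setT x); rewrite ?inE.
apply: for_ind => //; first by case: graph.
  by move=> x; rewrite inE.
move=> i A s' _ _ s'i IHA x.
rewrite !runE /= !updE /= s'i in_setU1 val_eqE addn1.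
by case: eqVneq => [->|_] //= /IHA.
Qed.

Lemma greedy_spec s : graph_loaded G cap s -> reals weight_arr w s ->
  exists D L, greedy_loaded G cap w D L (run greedy s) /\
    greedy_state G cap w k #|'I_n| D L.
Proof.
move=> graph sw; have init := init_greedy_spec graph sw.
rewrite /greedy run_seq; set s1 := run init_greedy s in init *.
pose J (A : {set 'I_n}) s' := exists D L, greedy_loaded G cap w D L s' /\
  greedy_state G cap w k #|A| D L.
suff : J setT (run (PFor step_ctr greedy_round) s1).
  by rewrite /J cardsT.
apply: for_ind => //; first by case: init => -[].
  by exists set0, (@Some _); rewrite cards0; split=> //; apply: greedy_state0.
move=> i A s' iA _ _ [D [L [loaded state]]].
have [D' [L' [loaded' step]]] := greedy_round_spec w_gt0 loaded.
exists D', L'; split=> //; rewrite cardsU1 iA.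
exact: (greedy_state_step conG cap_ge0 w_gt0 state step).
Qed.

End GreedyProgram.

Definition check_pair : prog :=
  PWhen (BAnd (ipos (icell label_arr outer_ctr))
          (ior (izero (icell set_arr outer_ctr))
            (BAnd (ipos (icell label_arr inner_ctr))
               (BNot (ieq (icell label_arr outer_ctr)
                          (icell label_arr inner_ctr))))))
    (PISet failed_reg (IConst 1)).

Definition check_vertex : prog := PFor inner_ctr check_pair.

Definition check_labels : prog := PFor outer_ctr check_vertex.

Definition min_vertex : prog :=
  PWhen (BAnd (ipos (icell set_arr outer_ctr))
          (BNot (BAnd (rpos (rreg min_cap_reg))
                   (BNot (BRle (rcell cap_arr outer_ctr) (rreg min_cap_reg))))))
    (PRSet min_cap_reg (rcell cap_arr outer_ctr)).

Definition min_capacity : prog :=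
  PRSet min_cap_reg (RConst 0);; PFor outer_ctr min_vertex.

Definition raise_vertex : prog :=
  PRStore weight_arr (ireg outer_ctr)
    (RAdd (rcell weight_arr outer_ctr)
       (RDiv (RMul (rcell weight_arr outer_ctr) (rreg min_cap_reg))
          (rcell cap_arr outer_ctr)));;
  PRStore load_arr (ireg outer_ctr)
    (RAdd (rcell load_arr outer_ctr) (rreg min_cap_reg)).

Definition record_vertex : prog :=
  PIStore out_set_arr (IAdd (ireg out_offset_reg) (ireg outer_ctr))
    (icell set_arr outer_ctr);;
  PWhen (ipos (icell set_arr outer_ctr)) raise_vertex.

Definition record_set : prog :=
  PRStore out_weight_arr (ireg count_reg) (rreg min_cap_reg);;
  PFor outer_ctr record_vertex;;
  PISet count_reg (IAdd (ireg count_reg) (IConst 1));;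
  PISet out_offset_reg (IAdd (ireg out_offset_reg) (ireg size_reg)).

Definition packing_round : prog :=
  greedy;; check_labels;; min_capacity;; record_set.

Section PackingRound.
Variables (R : realType) (n : nat) (G : sgraph 'I_n) (cap : 'I_n -> R).
Implicit Types (s : state R) (D A B : {set 'I_n}) (L : 'I_n -> option 'I_n).
Implicit Types (x y : 'I_n) (c : R) (pk : seq ({set 'I_n} * R)).
Local Notation graph_loaded := (graph_loaded G cap).

Lemma check_vertex_spec s D L x : imem s size_reg 0 = n ->
  set_at set_arr D s -> ints label_arr (label_code L) s ->
  imem s outer_ctr 0 = x ->
  (imem (run check_vertex s) failed_reg 0 == 0%N) =
    (imem s failed_reg 0 == 0%N) && [forall y, ~~ conflict D L x y].
Proof.
move=> s_n sD sL sx.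
pose J B s' := (imem s' failed_reg 0 == 0%N) =
  (imem s failed_reg 0 == 0%N) && \big[andb/true]_(y in B) ~~ conflict D L x y.
suff : J setT (run check_vertex s).
  rewrite /J big_andE => ->; congr (_ && _).
  by apply: eq_forallb => z; rewrite inE.
apply: for_ind => //; first by rewrite /J big_set0 andbT.
move=> y B s' yB ag s'y; rewrite /J big_setU1 //= => IHB.
have s'x : imem s' outer_ctr 0 = x by rewrite (agree_int ag).
have s'D : set_at set_arr D s' by apply: ints_agree ag _ sD.
have s'L : ints label_arr (label_code L) s' by apply: ints_agree ag _ sL.
rewrite run_if !bevalE /= s'x s'y s'D !s'L !label_code_gt0 label_code_eq eqb0.
rewrite -/(conflict D L x y).
by case: ifP => _; rewrite ?andbF // run_skip IHB.
Qed.

Lemma check_labels_spec s D L : imem s size_reg 0 = n ->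
  set_at set_arr D s -> ints label_arr (label_code L) s ->
  (imem (run check_labels s) failed_reg 0 == 0%N) =
    (imem s failed_reg 0 == 0%N) && [forall x, forall y, ~~ conflict D L x y].
Proof.
move=> s_n sD sL; pose J A s' := (imem s' failed_reg 0 == 0%N) =
  (imem s failed_reg 0 == 0%N) &&
  \big[andb/true]_(x in A) [forall y, ~~ conflict D L x y].
suff : J setT (run check_labels s).
  rewrite /J big_andE => ->; congr (_ && _).
  by apply: eq_forallb => z; rewrite inE.
apply: for_ind => //; first by rewrite /J big_set0 andbT.
move=> x A s' xA ag s'x; rewrite /J big_setU1 //= => IHA.
rewrite (@check_vertex_spec s' D L x) //.
- by rewrite IHA -andbA [X in _ && X]andbC.
- by rewrite (agree_int ag).
- exact: ints_agree ag _ sD.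
- exact: ints_agree ag _ sL.
Qed.

Lemma min_capacity_spec s D : graph_loaded s -> set_at set_arr D s ->
  {in D, forall x, 0 < cap x} ->
  admissible cap (D, rmem (run min_capacity s) min_cap_reg 0).
Proof.
move=> graph sD pos; rewrite /min_capacity run_seq run_rstore.
set s0 := rset _ _ _ _.
pose J A s' := admissible cap (A :&: D, rmem s' min_cap_reg 0).
suff : J setT (run (PFor outer_ctr min_vertex) s0) by rewrite /J setTI.
apply: for_ind => //; first by case: graph.
  by rewrite /J set0I; split=> [|x|] //=; [rewrite inE | left].
move=> x A s' _ ag s'x [/=]; set m := rmem s' min_cap_reg 0 => m_ge0 m_le m_min.
have s'D : imem s' set_arr x = (x \in D).
  by rewrite (agree_int ag) //; apply: sD.
have s'c : rmem s' cap_arr x = cap x.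
  by rewrite (agree_real ag) //; case: graph => _ _ _; apply.
rewrite /J setIU1 run_if !bevalE /= s'x s'D s'c lt0b -/m -ltNge.
case: ifP => xD /=; last by rewrite run_skip.
have cx := pos x xD; case: ifP => [better|/negbFE/andP[m_gt0 m_lt]].
  rewrite run_rstore /= s'x s'c updE /=; split=> /= [|y|]; first exact: ltW.
    case/setU1P=> [->//|yAD]; have [cy my] := m_le y yAD; split=> //.
    case: m_min => [[AD0]|[z zAD cz]]; first by rewrite AD0 inE in yAD.
    have [cz_gt0 _] := m_le z zAD; rewrite cz in cz_gt0.
    by move: better; rewrite cz_gt0 /= -leNgt => /le_trans; apply.
  by right; exists x; rewrite ?setU11.
rewrite run_skip; split=> //= [y /setU1P[->|/m_le//]|]; first by rewrite ltW.
right; case: m_min => [[_ m0]|[z zAD cz]]; first by rewrite m0 ltxx in m_gt0.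
by exists z; rewrite // inE zAD orbT.
Qed.

Definition recorded pk s : Prop :=
  [/\ graph_loaded s, reals weight_arr (weight cap pk) s,
      reals load_arr (load pk) s,
      imem s count_reg 0 = size pk /\
        imem s out_offset_reg 0 = (size pk * n)%N &
      forall i, (i < size pk)%N ->
        rmem s out_weight_arr i = (nth (set0, 0) pk i).2 /\
        forall x, imem s out_set_arr (i * n + x)%N =
          (x \in (nth (set0, 0) pk i).1)].

Definition keeps_recorded p : bool :=
  [&& keeps_graph p,
      ~~ has (mem (int_writes p)) [:: count_reg; out_set_arr; out_offset_reg] &
      ~~ has (mem (real_writes p)) [:: out_weight_arr; weight_arr; load_arr]].

Lemma recorded_run p s pk :
  keeps_recorded p -> recorded pk s -> recorded pk (run p s).
Proof.
rewrite /keeps_recorded /= !orbF !negb_or.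
case/and3P=> kept_graph /and3P[kept_count kept_sets kept_offset].
case/and3P=> kept_out kept_weight kept_load.
case=> graph sw sl [s_count s_off] old; split.
- exact: graph_loaded_run.
- exact: reals_run.
- exact: reals_run.
- by rewrite !imem_run.
move=> i lt_i; have [old_w old_set] := old i lt_i.
by rewrite rmem_run //; split=> // x; rewrite imem_run.
Qed.

Lemma record_vertex_spec s pk D c off x : graph_loaded s ->
  imem s outer_ctr 0 = x -> imem s out_offset_reg 0 = off ->
  rmem s min_cap_reg 0 = c -> set_at set_arr D s ->
  rmem s weight_arr x = weight cap pk x -> rmem s load_arr x = load pk x ->
  let s' := run record_vertex s in
  [/\ rmem s' weight_arr x = weight cap (rcons pk (D, c)) x,
      rmem s' load_arr x = load (rcons pk (D, c)) x,
      forall y, y != x -> rmem s' weight_arr y = rmem s weight_arr y /\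
        rmem s' load_arr y = rmem s load_arr y,
      imem s' out_set_arr (off + x)%N = (x \in D) &
      forall j, j != (off + x)%N ->
        imem s' out_set_arr j = imem s out_set_arr j].
Proof.
move=> [_ _ _ s_cap] sx s_off sc sD sw sl /=.
rewrite /record_vertex run_seq run_istore /= sx s_off sD.
set s1 := iset _ _ _ _; rewrite run_if beval_ipos.
have -> : ieval s1 (icell set_arr outer_ctr) = (x \in D).
  by rewrite /= !updE /= sx sD.
rewrite lt0b weight_rcons load_rcons; case: ifP => xD; last first.
  rewrite run_skip; split=> //; first by rewrite /= updE /= eqxx xD.
  by move=> j jx; rewrite /= updE /= (negPf jx).
rewrite /raise_vertex run_seq !run_rstore /= !updE /= sx sc sw sl s_cap.
split=> [||y yx||j jx].
- by rewrite eqxx.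
- by rewrite eqxx.
- by rewrite !updE /= val_eqE (negPf yx).
- by rewrite eqxx xD.
by rewrite updE /= (negPf jx).
Qed.

Lemma record_loop_spec s pk D c off : graph_loaded s ->
  imem s out_offset_reg 0 = off -> rmem s min_cap_reg 0 = c ->
  set_at set_arr D s -> reals weight_arr (weight cap pk) s ->
  reals load_arr (load pk) s ->
  let s' := run (PFor outer_ctr record_vertex) s in
  [/\ reals weight_arr (weight cap (rcons pk (D, c))) s',
      reals load_arr (load (rcons pk (D, c))) s',
      forall x, imem s' out_set_arr (off + x)%N = (x \in D) &
      forall j, (j < off)%N -> imem s' out_set_arr j = imem s out_set_arr j].
Proof.
move=> graph s_off sc sD sw sl /=; set w' := weight _ _; set l' := load _.
pose J A s' := [/\ reals weight_arr (patch A w' (weight cap pk)) s',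
  reals load_arr (patch A l' (load pk)) s',
  forall x, x \in A -> imem s' out_set_arr (off + x)%N = (x \in D) &
  forall j, (j < off)%N -> imem s' out_set_arr j = imem s out_set_arr j].
suff [/array_patchT new_w /array_patchT new_l row old] :
    J setT (run (PFor outer_ctr record_vertex) s).
  by split=> // x; rewrite row ?inE.
apply: for_ind => //; first by case: graph.
  split=> //; [exact: array_patch0 | exact: array_patch0 |].
  by move=> x; rewrite inE.
move=> x A s' xA ag s'x [s'w s'l rowA old].
have [] := @record_vertex_spec s' pk D c off x.
- exact: graph_loaded_agree ag _ graph.
- by [].
- by rewrite (agree_int ag).
- by rewrite (agree_real ag).
- exact: ints_agree ag _ sD.
- by rewrite s'w /patch (negPf xA).
- by rewrite s'l /patch (negPf xA).
move=> new_w new_l other row_x other_row; split=> [|||j j_off].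
- by apply: array_patchU1 new_w s'w => y /other[].
- by apply: array_patchU1 new_l s'l => y /other[].
- move=> y /setU1P[->//|yA]; rewrite other_row ?rowA // eqn_add2l val_eqE.
  by apply: contraNneq xA => <-.
by rewrite other_row ?old // ltn_eqF // (leq_trans j_off) // leq_addr.
Qed.

Lemma record_set_spec s pk D c : recorded pk s -> set_at set_arr D s ->
  rmem s min_cap_reg 0 = c -> recorded (rcons pk (D, c)) (run record_set s).
Proof.
move=> [graph sw sl [s_count s_off] old] sD sc.
rewrite /record_set run_seq run_rstore /= s_count sc.
set s1 := rset _ _ _ _; rewrite run_seq.
have graph1 : graph_loaded s1 by [].
have c1 : rmem s1 min_cap_reg 0 = c by [].
have [sw2 sl2 new_row old_rows] := record_loop_spec graph1 s_off c1 sD sw sl.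
set s2 := run (PFor _ _) s1 in sw2 sl2 new_row old_rows *.
have graph2 : graph_loaded s2 by apply: graph_loaded_run.
have s2_n : imem s2 size_reg 0 = n by case: graph2.
rewrite run_seq !run_istore /= !updE /=.
rewrite /recorded size_rcons; split=> //.
  split; rewrite /= !updE /= imem_run //= ?s_count ?addn1 //.
  by rewrite s_off s2_n mulSnr.
move=> i; rewrite ltnS nth_rcons => le_i.
have s2w : rmem s2 out_weight_arr i = rmem s1 out_weight_arr i.
  by rewrite rmem_run.
rewrite [rmem _ _ _]s2w /= updE /=.
case: ltnP => [lt_i|ge_i].
  have [old_w old_set] := old i lt_i; rewrite ltn_eqF // old_w; split=> // x.
  rewrite -old_set -[RHS]/(imem s1 out_set_arr _) -old_rows //.
  apply: leq_trans (_ : i.+1 * n <= _)%N; first by rewrite mulSnr ltn_add2l.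
  by rewrite leq_mul2r lt_i orbT.
have -> : i = size pk by apply/eqP; rewrite eqn_leq le_i.
by rewrite eqxx.
Qed.

Variable k : R.
Hypothesis conG : graph_connected G.
Hypothesis cap_ge0 : forall v, 0 <= cap v.

Definition cost_rate : R := 6 * ln n%:R / k.

Definition sound pk s : Prop :=
  [/\ {in pk, forall e, admissible cap e},
      imem s failed_reg 0 = 0%N ->
        {in pk, forall e, connected_dominating G e.1} &
      separable G cap k ->
        imem s failed_reg 0 = 0%N /\ cheap_history cap cost_rate pk].

Lemma sound_rcons s s' pk D L c : sound pk s ->
  greedy_state G cap (weight cap pk) k #|'I_n| D L -> admissible cap (D, c) ->
  (imem s' failed_reg 0 == 0%N) = (imem s failed_reg 0 == 0%N) &&
    [forall x, forall y, ~~ conflict D L x y] ->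
  sound (rcons pk (D, c)) s'.
Proof.
move=> [adm cds sep_pk] state admD failedE; have [lab _ _] := state.
split=> [e|/eqP|sep].
- by rewrite mem_rcons inE => /predU1P[->|/adm].
- rewrite failedE => /andP[/eqP/cds cds_pk /forallP free] e.
  rewrite mem_rcons inE => /predU1P[-> /=|/cds_pk//].
  by apply: (conflict_free_connected_dominating conG lab) => x y;
    have /forallP := free x.
have [s_ok cheap] := sep_pk sep; have [n_gt1 k_gt0 _] := sep.
have [one_label costD] := greedy_state_final conG state sep.
split.
  apply/eqP; rewrite failedE s_ok eqxx /=.
  apply/forallP => x; apply/forallP => y.
  by apply: single_label_conflict_free lab one_label.
apply: CheapRcons => //; rewrite /cost_rate mulrAC ler_pdivlMr // mulrC.
by rewrite card_ord in costD; rewrite [leRHS]mulrAC.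
Qed.

Lemma packing_round_spec s pk : recorded pk s -> sound pk s ->
  exists e, recorded (rcons pk e) (run packing_round s) /\
    sound (rcons pk e) (run packing_round s).
Proof.
move=> rec snd; have [graph sw _ _ _] := rec; have [adm _ _] := snd.
have w_gt0 := weight_gt0 cap_ge0 adm.
have [D [L [[graph1 D1 L1 _] state]]] :=
  greedy_spec k conG cap_ge0 w_gt0 graph sw.
have [_ pos _] := state.
rewrite /packing_round run_seq; set s1 := run greedy s in graph1 D1 L1 *.
have s1_n : imem s1 size_reg 0 = n by case: graph1.
have failedE := check_labels_spec s1_n D1 L1.
rewrite run_seq; set s2 := run check_labels s1 in failedE *.
have graph2 : graph_loaded s2 by apply: graph_loaded_run.
have D2 : set_at set_arr D s2 by apply: ints_run.
have admD := min_capacity_spec graph2 D2 pos.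
rewrite run_seq; set s3 := run min_capacity s2 in admD *.
have rec3 : recorded pk s3 by do 3 apply: recorded_run => //.
exists (D, rmem s3 min_cap_reg 0); split.
  by apply: record_set_spec => //; apply: ints_run.
apply: sound_rcons snd state admD _.
by rewrite imem_run // [imem s3 _ _]imem_run // failedE [imem s1 _ _]imem_run.
Qed.

End PackingRound.

(** * The whole program *)

Definition init_row : prog :=
  PFor inner_ctr (PIStore row_arr (ireg outer_ctr)
                    (IAdd (icell row_arr outer_ctr) (ireg outer_ctr))).

Definition init_vertex : prog :=
  init_row;;
  PRStore weight_arr (ireg outer_ctr)
    (RDiv (RConst 1) (rcell cap_arr outer_ctr)).

Definition setup : prog := PFor outer_ctr init_vertex.

Definition packing_rounds : prog := foldr PFor packing_round round_ctrs.

Definition relative_load : rexp :=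
  RDiv (rcell load_arr outer_ctr) (rcell cap_arr outer_ctr).

Definition max_vertex : prog :=
  PIf (BRle relative_load (rreg max_load_reg)) PSkip
    (PRSet max_load_reg relative_load).

Definition find_max_load : prog :=
  PRSet max_load_reg (RConst 0);; PFor outer_ctr max_vertex.

Definition scale_weight : prog :=
  PRStore out_weight_arr (ireg out_index_reg)
    (RDiv (rcell out_weight_arr out_index_reg) (rreg max_load_reg));;
  PISet out_index_reg (IAdd (ireg out_index_reg) (IConst 1)).

Definition scale_weights : prog :=
  PISet out_index_reg (IConst 0);; foldr PFor scale_weight round_ctrs.

Definition packing_program : prog :=
  setup;; packing_rounds;; find_max_load;; scale_weights;;
  PWhen (ipos (ireg failed_reg)) (PISet count_reg (IConst 0)).

Section Program.
Variables (R : realType) (n : nat) (G : sgraph 'I_n) (cap : 'I_n -> R).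
Implicit Types (s : state R) (A : {set 'I_n}) (x : 'I_n).
Implicit Types pk : seq ({set 'I_n} * R).
Local Notation graph_loaded := (graph_loaded G cap).

Lemma input_adj (i j : 'I_n) : imem (input G cap) adj_arr (i * n + j)%N = G i j.
Proof.
rewrite /=; congr nat_of_bool; apply/existsP/idP => [[i' /existsP[j']]|Gij].
  case/andP=> /eqP ij; have n_gt0 := leq_ltn_trans (leq0n i) (ltn_ord i).
  have := congr1 (divn^~ n) ij; have := congr1 (modn^~ n) ij.
  rewrite !modnMDl !divnMDl // !modn_small // !divn_small // !addn0.
  by move=> /val_inj-> /val_inj->.
by exists i; apply/existsP; exists j; rewrite eqxx.
Qed.

Lemma init_row_spec s x : imem s size_reg 0 = n -> imem s outer_ctr 0 = x ->
  imem s row_arr x = 0%N ->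
  imem (run init_row s) row_arr x = (x * n)%N /\
  forall y : 'I_n, y != x -> imem (run init_row s) row_arr y = imem s row_arr y.
Proof.
move=> s_n sx s0; pose J A s' := imem s' row_arr x = (#|A| * x)%N /\
  forall y : 'I_n, y != x -> imem s' row_arr y = imem s row_arr y.
suff [rowT other] : J setT (run init_row s).
  by split=> //; rewrite rowT cardsT card_ord mulnC.
apply: for_ind => //; first by rewrite /J cards0.
move=> y A s' yA ag s'y [rowA other].
have s'x : imem s' outer_ctr 0 = x by rewrite (agree_int ag).
rewrite run_istore /= s'x; split=> [|z zx]; rewrite /= updE /=.
  by rewrite eqxx cardsU1 yA rowA mulSn addnC.
by rewrite val_eqE (negPf zx) other.
Qed.

Lemma setup_spec : graph_loaded (run setup (input G cap)) /\
  reals weight_arr (weight cap [::]) (run setup (input G cap)).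
Proof.
pose J A s := ints row_arr (patch A (fun x : 'I_n => x * n)%N (fun=> 0%N)) s /\
  reals weight_arr (patch A (weight cap [::]) (fun=> 0)) s.
have input_cap : reals cap_arr cap (input G cap) by move=> x; rewrite /= valK.
suff [/array_patchT rowT /array_patchT weightT] :
    J setT (run setup (input G cap)).
  split=> //; split=> // [|i j|].
  - by rewrite imem_run.
  - by rewrite imem_run // input_adj.
  exact: reals_run.
apply: for_ind => //; first by split; apply: array_patch0.
move=> x A s xA ag sx [rowA weightA].
have s_n : imem s size_reg 0 = n by rewrite (agree_int ag).
have s0 : imem s row_arr x = 0%N by rewrite rowA /patch (negPf xA).
have [row_x other] := init_row_spec s_n sx s0.
rewrite /init_vertex run_seq run_rstore; split.
  exact: array_patchU1 other row_x rowA.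
have s_cap : rmem (run init_row s) cap_arr x = cap x.
  by rewrite rmem_run // (agree_real ag).
rewrite /= [imem _ outer_ctr 0]imem_run // sx s_cap.
apply: array_patchU1 weightA => [y yx|].
  by rewrite /= updE /= val_eqE (negPf yx) rmem_run.
by rewrite /= updE /= eqxx /weight big_nil mulr1 mul1r.
Qed.

Lemma find_max_load_spec s pk : graph_loaded s -> reals load_arr (load pk) s ->
  rmem (run find_max_load s) max_load_reg 0 = max_load cap pk.
Proof.
move=> graph sl; rewrite /find_max_load run_seq run_rstore /=.
set s0 := rset _ _ _ _; pose ratio x := load pk x / cap x.
pose J A s' := rmem s' max_load_reg 0 = \big[Num.max/0]_(x in A) ratio x.
suff : J setT (run (PFor outer_ctr max_vertex) s0).
  by rewrite /J => ->; apply: eq_bigl => x; rewrite inE.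
apply: for_ind => //; first by case: graph.
  by rewrite /J big_set0.
move=> x A s' xA ag s'x; rewrite /J => maxA.
have s'l : rmem s' load_arr x = load pk x.
  by rewrite (agree_real ag) //; apply: sl.
have s'c : rmem s' cap_arr x = cap x.
  by rewrite (agree_real ag) //; case: graph => _ _ _; apply.
have ratioE : reval s' relative_load = ratio x by rewrite /= s'x s'l s'c.
rewrite (bigmaxD1 x) ?setU11 //=.
rewrite (eq_bigl (mem A)) => [|y]; last first.
  by rewrite /= in_setU1; case: eqVneq => [->|]; rewrite /= ?(negPf xA) ?andbT.
rewrite run_if beval_rle [reval _ (rreg _)]/= maxA ratioE run_rstore ratioE.
by case: leP => _; rewrite ?run_skip //= updE.
Qed.

Lemma scale_weights_spec s : imem s size_reg 0 = n ->
  forall i, (i < n ^ 3)%N -> rmem (run scale_weights s) out_weight_arr i =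
    rmem s out_weight_arr i / rmem s max_load_reg 0.
Proof.
move=> s_n i lt_i; set lam := rmem s max_load_reg 0.
rewrite /scale_weights run_seq run_istore /=; set s0 := iset _ _ _ _.
pose J t s' := [/\ imem s' size_reg 0 = n, imem s' out_index_reg 0 = t,
  rmem s' max_load_reg 0 = lam & forall j, rmem s' out_weight_arr j =
    if (j < t)%N then rmem s out_weight_arr j / lam
    else rmem s out_weight_arr j].
suff [_ _ _ ->] : J (0 + n ^ size round_ctrs)%N
    (run (foldr PFor scale_weight round_ctrs) s0).
  by rewrite add0n lt_i.
apply: nested_for_ind => //.
- by move=> x j v s'; rewrite !inE => /or3P[]/eqP->.
- by move=> t s' [].
move=> t s' [s'_n s't s'lam s'w].
rewrite /scale_weight run_seq run_rstore run_istore.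
split=> //=; first by rewrite updE /= s't addn1.
move=> j; rewrite updE /= s't s'lam !s'w ltnn ltnS [(j <= t)%N]leq_eqVlt.
by case: eqVneq => [->|].
Qed.

Section Output.
Hypothesis conG : graph_connected G.
Hypothesis cap_ge0 : forall v, 0 <= cap v.
Local Notation final := (run packing_program (input G cap)).

Lemma packing_rounds_spec k : exists pk, size pk = (n ^ 3)%N /\
  let s := run packing_rounds (run setup (input G cap)) in
  recorded G cap pk s /\ sound G cap k pk s.
Proof.
pose J t s := exists pk,
  size pk = t /\ recorded G cap pk s /\ sound G cap k pk s.
rewrite -[(n ^ 3)%N]add0n -[3%N]/(size round_ctrs).
apply: (nested_for_ind (n := n) (J := J)) => //.
- by move=> x i v s; rewrite !inE => /or3P[]/eqP->.
- by move=> i s [pk [_ [[[]]]]].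
- move=> i s [pk [<- [rec snd]]].
  have [e [rec' snd']] := packing_round_spec conG cap_ge0 rec snd.
  by exists (rcons pk e); rewrite size_rcons.
have [graph weight0] := setup_spec; exists [::]; split=> //; split.
  split=> //; first by move=> x; rewrite rmem_run // /load big_nil.
  by rewrite !imem_run.
split=> [e|_ e|_]; rewrite ?in_nil //.
by rewrite imem_run //; split=> //; apply: CheapNil.
Qed.

Definition outputs pk s : Prop :=
  out_count s = size pk /\ forall i : 'I_(out_count s),
    @out_set R n s i = (nth (set0, 0) pk i).1 /\
    @out_weight R s i = (nth (set0, 0) pk i).2 / max_load cap pk.

Definition valid_output pk s : Prop :=
  outputs pk s /\ {in pk, forall e, connected_dominating G e.1}.

Lemma cd_packing_no_output s : out_count s = 0%N ->
  cd_packing G cap (@out_set R n s) (@out_weight R s).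
Proof.
move=> s0; have none (i : 'I_(out_count s)) : False by case: i; rewrite s0.
by split=> [i|i|v]; [case: (none i) | case: (none i) |];
  rewrite big1 // => i; case: (none i).
Qed.

Lemma cd_packing_valid_output pk s : valid_output pk s ->
  {in pk, forall e, admissible cap e} ->
  cd_packing G cap (@out_set R n s) (@out_weight R s).
Proof.
move=> [[s_count out] cds] adm.
have nth_in (i : 'I_(out_count s)) : nth (set0, 0) pk i \in pk.
  by rewrite mem_nth // -s_count.
split=> [i|i|v].
- by have [-> _] := out i; apply: cds.
- have [_ ->] := out i; have [e_ge0 _ _] := adm _ (nth_in i).
  by rewrite divr_ge0 // max_load_ge0.
have -> : \sum_(i | v \in @out_set R n s i) @out_weight R s i =
    load pk v / max_load cap pk.
  rewrite /load (big_nth (set0, 0)) big_mkord -s_count mulr_suml.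
  by apply: eq_big => [i|i _]; have [set_i w_i] := out i; rewrite ?set_i ?w_i.
have /predU1P[->|max_gt0] : (max_load cap pk == 0) || (0 < max_load cap pk).
- by rewrite -le0r max_load_ge0.
- by rewrite invr0 mulr0.
by rewrite ler_pdivrMr // mulrC (load_le_max cap_ge0 adm).
Qed.

Lemma sum_outputs pk s : outputs pk s ->
  \sum_i @out_weight R s i = total_weight pk / max_load cap pk.
Proof.
move=> [s_count out].
rewrite /total_weight (big_nth (set0, 0)) big_mkord -s_count mulr_suml.
by apply: eq_bigr => i _; have [_ ->] := out i.
Qed.

Lemma packing_program_output k : exists pk,
  [/\ size pk = (n ^ 3)%N, {in pk, forall e, admissible cap e},
      out_count final = 0%N \/ valid_output pk final &
      separable G cap k ->
        valid_output pk final /\ cheap_history cap (cost_rate n k) pk].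
Proof.
have [pk [pk_size [rec [adm cds sep_pk]]]] := packing_rounds_spec k.
set s1 := run _ _ in rec cds sep_pk; pose s2 := run find_max_load s1.
have [graph _ sl [s_count _] old] := rec.
have s2_n : imem s2 size_reg 0 = n by rewrite imem_run //; case: graph.
pose s3 := run scale_weights s2.
have failedE : imem s3 failed_reg 0 = imem s1 failed_reg 0.
  by rewrite imem_run // imem_run.
have finalE : final = if (0 < imem s3 failed_reg 0)%N then iset count_reg 0 0 s3
    else s3.
  by [].
have out_ok : imem s1 failed_reg 0 = 0%N -> outputs pk final.
  move=> s_ok; rewrite finalE failedE s_ok /=.
  have s3_count : out_count s3 = size pk.
    by rewrite /out_count -s_count imem_run // imem_run.
  split=> // i; have lt_i : (i < size pk)%N by rewrite -s3_count.
  have [w_i set_i] := old i lt_i; split.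
    apply/setP => x; rewrite inE imem_run // imem_run // set_i.
    by rewrite eqb0 negbK.
  rewrite /out_weight scale_weights_spec // -?pk_size //.
  by rewrite (find_max_load_spec graph sl) rmem_run // w_i.
exists pk; split=> // [|/sep_pk[s_ok cheap]]; last first.
  by split=> //; split; [apply: out_ok | apply: cds].
have [s_ok|s_fail] := posnP (imem s1 failed_reg 0).
  by right; split; [apply: out_ok | apply: cds].
by left; rewrite finalE failedE s_fail.
Qed.

Lemma packing_program_cd_packing :
  cd_packing G cap (@out_set R n final) (@out_weight R final).
Proof.
have [pk [_ adm [no_output|valid] _]] := packing_program_output 0.
  exact: cd_packing_no_output.
exact: cd_packing_valid_output valid adm.
Qed.

Lemma packing_program_size_ge k : separable G cap k ->
  1 / 24 * k / ln n%:R <= \sum_i @out_weight R final i.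
Proof.
move=> sep; have [pk [pk_size adm _]] := packing_program_output k.
case/(_ sep)=> -[out cds] cheap.
have [n_gt1 k_gt0 _] := sep; rewrite card_ord in n_gt1.
have ln_gt0 : 0 < ln n%:R :> R by rewrite ln_gt0 ?ltr1n.
rewrite (sum_outputs out) (_ : _ / _ = 1 / (4 * cost_rate n k)); last first.
  by rewrite /cost_rate; field; rewrite !gt_eqF.
apply: packing_size_ge cheap; rewrite ?card_ord ?(ltnW n_gt1) //.
  by move=> e /cds[_ []].
by rewrite /cost_rate divr_gt0 // mulr_gt0.
Qed.

End Output.
End Program.

Theorem theorem2 (R : realType) :
  exists (c : R) (P : cmd) (p : {poly nat}),
    0 < c /\
    forall (n : nat) (G : sgraph 'I_n) (cap : 'I_n -> R),
      graph_connected G -> (forall v, 0 <= cap v) ->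
      exists (t : nat) (s : state R),
        [/\ exec P (input G cap) t s,
            (t <= p.[n])%N,
            cd_packing G cap (@out_set R n s) (@out_weight R s) &
            forall k : R, min_separator_capacity G cap k ->
              c * k / ln n%:R <= \sum_i @out_weight R s i].
Proof.
exists (1 / 24), (compile packing_program), (time_bound packing_program).
split=> [|n G cap conG cap_ge0]; first by rewrite divr_gt0.
have [t halts t_le] :=
  compile_run (input G cap) (isT : well_formed packing_program).
have valid := packing_program_cd_packing conG cap_ge0.
exists t, (run packing_program (input G cap)); split=> // k [[S sepS <-] k_min].
have /predU1P[->|k_gt0] : (capacity cap S == 0) || (0 < capacity cap S).
- by rewrite -le0r; apply: sumr_ge0.
- by rewrite mulr0 mul0r; apply: sumr_ge0 => i _; case: valid.
apply: packing_program_size_ge => //.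
split; [exact: card_separated_graph sepS | exact: k_gt0 |].
by split; [exact: k_min | exact/capacityS/subsetT].
Qed.
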